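(* Let $d\ge2$ and let $\mathbf P$ be a stationary, ergodic probability measure on the space of bounded functions $\eta:\mathbb{Z}^d\to\mathbb{R}$ such that, for some $\eta_{\min},\eta_{\max}\in\mathbb{R}$, $\mathbf P[\eta_{\min}\le\eta(x)\le\eta_{\max}]=1$ for every $x\in\mathbb{Z}^d$. Let $W\subset\mathbb{R}^d$ be a bounded Lipschitz domain and $W_n=\mathbb{Z}^d\cap nW$. Let $v_n$ be the divisible sandpile odometer function for $\eta$ in $W_n$, and let $v_{avg_n}$ be the divisible sandpile odometer function in $W_n$ for the constant initial sandpile $\eta_{avg}:=\mathbf{E}(\eta(0))$. Then, on an event of full probability, as $n\to\infty$, the rescaled functions $\bar v_n(x):=n^{-2}v_n([nx])$ and $\bar v_{avg_n}(x):=n^{-2}v_{avg_n}([nx])$ converge uniformly together: $$\sup_{x\in n^{-1}\bar W_n}|\bar v_n(x)-\bar v_{avg_n}(x)|\to0.$$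
   Context: For $x,y\in\mathbb{Z}^d$, $y\sim x$ means $|y-x|_2=1$, and $\Delta_{\mathbb{Z}^d}f(x)=\sum_{y\sim x}(f(y)-f(x))$. For $A\subset\mathbb{Z}^d$, $\partial A=\{y\in\mathbb{Z}^d\setminus A:\exists x\in A,\ y\sim x\}$, $\bar A=A\cup\partial A$. $[\cdot]$ denotes rounding to the lattice (on $n^{-1}\bar W_n$ one has $[nx]=nx$). The space of bounded functions $\eta:\mathbb{Z}^d\to\mathbb{R}$ carries the $\sigma$-algebra generated by the coordinate maps. With $(T_y\eta)(z)=\eta(y+z)$ and $T_yE=\{T_y\eta:\eta\in E\}$: stationary means $\mathbf P(T_yE)=\mathbf P(E)$ for all events $E$ and $y\in\mathbb{Z}^d$; ergodic means $E=\bigcap_yT_yE$ implies $\mathbf P(E)\in\{0,1\}$. For finite $V\subset\mathbb{Z}^d$ and a (fractional) distribution of sand $\eta:V\to\mathbb{R}$, the divisible sandpile odometer function for $\eta$ in $V$ is the pointwise minimum $$v=\min\{f:\bar V\to[0,\infty):\ \Delta_{\mathbb{Z}^d}f+\eta\le1\text{ in }V\}.$$ *)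

(* Defs.v *)
From HB Require Import structures.
From mathcomp Require Import all_boot all_order all_algebra.
From mathcomp Require Import all_classical all_reals all_analysis.
From mathcomp Require Import zify ring lra.

Set Implicit Arguments.
Unset Strict Implicit.
Unset Printing Implicit Defensive.

Import Order.TTheory GRing.Theory Num.Theory.
Import numFieldNormedType.Exports.

Local Open Scope classical_set_scope.
Local Open Scope ring_scope.

Section Lattice.
Context (R : realType) (d : nat).
Implicit Types (x y z : 'rV[int]_d) (A V : set 'rV[int]_d).

Definition norm2 (u : 'rV[R]_d) : R := Num.sqrt (\sum_i u 0 i ^+ 2).

Definition to_real z : 'rV[R]_d := map_mx intr z.

Definition nbr x : set 'rV[int]_d := [set y | norm2 (to_real (y - x)) = 1].

(* [nbr x] is finite ([finite_nbr]), so this is the usual finite sum; see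
   [laplacianE] for the explicit form. *)
Definition laplacian (f : 'rV[int]_d -> R) x : R :=
  \sum_(y \in nbr x) (f y - f x).

Definition lstep (p : 'I_d * bool) : 'rV[int]_d :=
  (-1) ^+ p.2 *: delta_mx 0 p.1.

Lemma nbrE x y : nbr x y <-> \sum_i (y 0 i - x 0 i) ^+ 2 = 1.
Proof.
rewrite /nbr /= /norm2; set S := (S in Num.sqrt S).
have ST : S = (\sum_i (y 0 i - x 0 i) ^+ 2)%:~R.
  rewrite /S rmorph_sum /=; apply: eq_bigr => i _.
  by rewrite !mxE rmorphXn.
have S0 : 0 <= S by rewrite /S; apply: sumr_ge0 => i _; exact: sqr_ge0.
split=> [S1|T1].
  have : S = 1 by rewrite -(sqr_sqrtr S0) S1 expr1n.
  by rewrite ST -[1 in RHS]/(1%:~R) => /intr_inj.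
by rewrite ST T1 sqrtr1.
Qed.

Lemma nbr_lstepE x : nbr x = [set x + lstep p | p in setT].
Proof.
apply/seteqP; split => y /=; last first.
  move=> [[i b] _ <-]; apply/nbrE; rewrite (bigD1 i) //= big1 => [|j ji].
    by rewrite addr0 !mxE !eqxx mulr1 addrAC subrr add0r sqrr_sign.
  by rewrite !mxE eqxx (negbTE ji) mulr0 addr0 subrr expr0n.
move/nbrE => S1.
have [i yi] : exists i, y 0 i - x 0 i != 0.
  apply/not_existsP => H; move: S1; rewrite big1 // => i _.
  by have /negP/negPn/eqP -> := H i; rewrite expr0n.
have sq_ge1 (t : int) : t != 0 -> 1 <= t ^+ 2.
  by move=> t0; rewrite -gtz0_ge1 lt_neqAle sqr_ge0 eq_sym sqrf_eq0 t0.
move: S1; rewrite (bigD1 i) //=; set r := \sum_(j | _) _ => S1.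
have r0 : 0 <= r by apply: sumr_ge0 => j _; exact: sqr_ge0.
have yi1 : (y 0 i - x 0 i) ^+ 2 = 1.
  by apply/eqP; rewrite eq_le sq_ge1 // andbT -S1 lerDl.
have {}r0 : r = 0 by move: S1; rewrite yi1 -{2}[1]addr0 => /addrI.
exists (i, y 0 i - x 0 i == -1) => //; apply/rowP => j; rewrite !mxE /=.
have [->|ji] := eqVneq j i.
  rewrite mulr1; move/eqP: yi1; rewrite sqrf_eq1 => /orP[] /eqP e; rewrite e.
    by apply/esym/eqP; rewrite addrC -subr_eq e.
  by apply/esym/eqP; rewrite addrC -subr_eq e.
rewrite mulr0 addr0; apply/eqP; rewrite eq_sym -subr_eq0 -sqrf_eq0; apply/eqP.
by move/psumr_eq0P: r0 => /(_ (fun k _ => sqr_ge0 _)) /(_ j ji).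
Qed.

Lemma lstep_inj : injective lstep.
Proof.
move=> [i b] [j c] /rowP e.
have := e i; rewrite !mxE !eqxx mulr1.
have [<-|ij] /= := eqVneq i j; last by move=> /eqP; rewrite mulr0 signr_eq0.
by rewrite mulr1; case: b c {e} => -[].
Qed.

Lemma finite_nbr x : finite_set (nbr x).
Proof. by rewrite nbr_lstepE; apply: finite_image; exact: finite_finset. Qed.

Lemma laplacian_lstepE f x : laplacian f x = \sum_p (f (x + lstep p) - f x).
Proof.
rewrite /laplacian nbr_lstepE fsbig_image /=; last first.
  by move=> p q _ _ /addrI /lstep_inj.
rewrite (fsbigE (index_enum _)) ?index_enum_uniq //.
  by apply: eq_bigl => p; rewrite in_setT.
by move=> p _; rewrite mem_index_enum.
Qed.

Lemma laplacianE f x : laplacian f x =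
  \sum_i (f (x + delta_mx 0 i) + f (x - delta_mx 0 i) - f x *+ 2).
Proof.
rewrite laplacian_lstepE.
rewrite -(pair_bigA _ (fun i b => f (x + lstep (i, b)) - f x)) /=.
apply: eq_bigr => i _; rewrite big_bool /= /lstep /= expr0 expr1 scale1r scaleN1r.
by rewrite mulr2n opprD addrACA [f (x - _) + _]addrC.
Qed.

Definition lboundary A : set 'rV[int]_d :=
  [set y | ~ A y /\ exists2 x, A x & nbr x y].

Definition lclosure A : set 'rV[int]_d := A `|` lboundary A.

(* A function on the closure of V is represented by a function on the whole
   lattice; only its values on the closure of V are constrained. *)
Definition stabilizing V (eta : 'rV[int]_d -> R) : set ('rV[int]_d -> R) :=
  [set f | (forall x, lclosure V x -> 0 <= f x) /\
           (forall x, V x -> laplacian f x + eta x <= 1)].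

(* For finite V the infimum is attained on the closure of V, simultaneously at
   all points, by an element of [stabilizing V eta]: see [odometer_min]. *)
Definition odometer V (eta : 'rV[int]_d -> R) x : R :=
  inf [set f x | f in stabilizing V eta].

Lemma finite_lclosure V : finite_set V -> finite_set (lclosure V).
Proof.
move=> fV; rewrite finite_setU; split=> //.
apply: (sub_finite_set (B := \bigcup_(x in V) nbr x)).
  by move=> y [_ [x Vx xy]]; exists x.
by apply: bigcup_finite => // x _; exact: finite_nbr.
Qed.

Lemma stabilizing_nonempty V eta : (0 < d)%N -> finite_set V ->
  stabilizing V eta !=set0.
Proof.
move=> d0 fV; pose i0 := Ordinal d0.
have bnd A (g : 'rV[int]_d -> R) : finite_set A ->
    exists2 M : R, 0 <= M & forall x, A x -> g x <= M.
  move=> /finite_seqP[B ->]; exists (\sum_(x <- B) `|g x|).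
    by apply: sumr_ge0.
  move=> x /= xB; rewrite (big_rem x) //=; apply: (le_trans (ler_norm _)).
  by rewrite lerDl; apply: sumr_ge0.
have [K K0 HK] := bnd V (fun x => eta x - 1) fV.
pose q x : R := K * (x 0 i0)%:~R ^+ 2.
have [C C0 HC] := bnd _ q (finite_lclosure fV).
exists (fun x => C - q x); split=> [x Vx|x Vx]; first by rewrite subr_ge0 HC.
have -> : laplacian (fun x => C - q x) x = - (K *+ 2).
  rewrite laplacianE (bigD1 i0) //= big1 => [|i].
    by rewrite /q !mxE !eqxx !rmorphD /= rmorphN /=; ring.
  rewrite eq_sym => /negbTE ii0; rewrite /q !mxE eqxx ii0 /=.
  by rewrite ?addr0 ?subr0 ?addr0; ring.
have := HK x Vx; lra.
Qed.

(* The odometer is the least element, pointwise on the closure of V, of the set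
   over which the minimum is taken. *)
Lemma odometer_min V eta : (0 < d)%N -> finite_set V ->
  stabilizing V eta (odometer V eta) /\
  forall f, stabilizing V eta f ->
    forall x, lclosure V x -> odometer V eta x <= f x.
Proof.
move=> d0 fV; have [f0 Sf0] := stabilizing_nonempty eta d0 fV.
have lb x : lclosure V x ->
    lbound [set f x | f in stabilizing V eta] 0.
  by move=> Vx _ [f [f_ge0 _] <-]; exact: f_ge0.
have ne x : [set f x | f in stabilizing V eta] !=set0 by exists (f0 x), f0.
have le f : stabilizing V eta f ->
    forall x, lclosure V x -> odometer V eta x <= f x.
  move=> Sf x Vx; apply: ge_inf; last by exists f.
  by exists 0; exact: lb.
split=> //; split=> [x Vx|x Vx]; first by apply: lb_le_inf => //; exact: lb.
have nbr_cl p : lclosure V (x + lstep p).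
  have [?|nV] := pselect (V (x + lstep p)); first by left.
  right; split=> //; exists x => //; rewrite nbr_lstepE; by exists p.
pose N : R := #|{: 'I_d * bool}|%:R.
have N0 : 0 < N by rewrite ltr0n card_prod card_ord card_bool muln_gt0 d0.
have lapE g : laplacian g x = \sum_p g (x + lstep p) - N * g x.
  by rewrite laplacian_lstepE big_split /= sumr_const mulNrn mulr_natl.
set v := odometer V eta.
suff : (\sum_p v (x + lstep p) + eta x - 1) / N <= v x.
  by rewrite ler_pdivrMr // lapE mulrC; lra.
apply: lb_le_inf => // _ [f Sf <-].
have /= := Sf.2 x Vx; rewrite lapE => H.
rewrite ler_pdivrMr // mulrC.
have : \sum_p v (x + lstep p) <= \sum_p f (x + lstep p).
  by apply: ler_sum => p _; exact: le.
by lra.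
Qed.

Definition lround (u : 'rV[R]_d) : 'rV[int]_d :=
  map_mx (fun t => Num.floor (t + 2^-1)) u.

Lemma lround_to_real z : lround (to_real z) = z.
Proof.
apply/rowP => i; rewrite !mxE; apply: floor_def.
rewrite lerDl invr_ge0 ler0n /= rmorphD /= ltrD2l.
by rewrite invf_lt1 ?ltr1n ?ltr0n.
Qed.

Definition blowup (W : set 'rV[R]_d) (n : nat) : set 'rV[int]_d :=
  [set z | exists2 w, W w & to_real z = n%:R *: w].

Lemma finite_blowup W n : bounded_set W -> finite_set (blowup W n).
Proof.
move=> [M0 [_ /(_ (M0 + 1))]]; rewrite ltrDl ltr01 => /(_ isT) /=.
set M := M0 + 1 => HM; have [N HN] : exists N : nat, n%:R * M <= N%:R.
  exists (Num.bound `|n%:R * M|); apply: (le_trans (ler_norm _)).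
  exact/ltW/archi_boundP/normr_ge0.
pose g (h : {ffun 'I_d -> 'I_(N.*2.+1)}) : 'rV[int]_d :=
  \row_i ((h i : nat)%:Z - N%:Z).
apply: (sub_finite_set (B := [set g h | h in setT])); last first.
  by apply: finite_image; exact: finite_finset.
move=> z [w Ww zw].
have zN i : `|z 0 i| <= N%:Z.
  rewrite -(ler_int R) intr_norm.
  have -> : (z 0 i)%:~R = n%:R * w 0 i by move/rowP: zw => /(_ i); rewrite !mxE.
  rewrite normrM normr_nat; apply: le_trans HN; rewrite ler_wpM2l //.
  apply: le_trans (HM _ Ww); rewrite /Num.norm /= mx_normE.
  exact: (le_bigmax _ (fun ij : 'I_1 * 'I_d => `|w ij.1 ij.2|%:nng) (0, i)).
exists [ffun i => inord (absz (z 0 i + N%:Z))] => //.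
apply/rowP => i; rewrite !mxE ffunE inordK; have := zN i; lia.
Qed.

Definition scaled_closure (W : set 'rV[R]_d) (n : nat) : set 'rV[R]_d :=
  [set n%:R^-1 *: to_real z | z in lclosure (blowup W n)].

Definition rescale (n : nat) (v : 'rV[int]_d -> R) (u : 'rV[R]_d) : R :=
  n%:R ^- 2 * v (lround (n%:R *: u)).

(* Near each boundary point, after an orthogonal change of coordinates, W is
   the strict epigraph, in the direction of the i-th coordinate, of a Lipschitz
   function of the other d - 1 coordinates. *)
Definition lipschitz_boundary (W : set 'rV[R]_d) : Prop :=
  forall p, (closure W `\` W°) p ->
    exists (Q : 'M[R]_d) (i : 'I_d) (phi : 'rV[R]_d.-1 -> R),
      [/\ Q *m Q^T = 1%:M,
          [lipschitz phi u | u in setT] &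
          \forall x \near p, W x <-> phi (col' i (x *m Q)) < (x *m Q) 0 i].

Definition bounded_lipschitz_domain (W : set 'rV[R]_d) : Prop :=
  [/\ W !=set0, open W, connected W, bounded_set W & lipschitz_boundary W].

End Lattice.

Section Environment.
Context (R : realType) (d : nat).

Record bounded_field : Type := BoundedField {
  field_fun :> 'rV[int]_d -> R;
  field_bounded : bounded_fun field_fun
}.

HB.instance Definition _ := gen_eqMixin bounded_field.
HB.instance Definition _ := gen_choiceMixin bounded_field.

Lemma bounded_field0_subproof : bounded_fun ((fun=> 0) : 'rV[int]_d -> R).
Proof. by exists 0; split=> // M M0 x _ /=; rewrite normr0 ltW. Qed.

HB.instance Definition _ :=
  isPointed.Build bounded_field (BoundedField bounded_field0_subproof).

Definition coordinate_events : set (set bounded_field) :=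
  \bigcup_(x in [set: 'rV[int]_d])
    preimage_set_system setT (fun eta : bounded_field => eta x) measurable.

Definition environment : Type := g_sigma_algebraType coordinate_events.

HB.instance Definition _ := Measurable.on environment.

Coercion environment_field (eta : environment) : bounded_field := eta.

Lemma shift_subproof (y : 'rV[int]_d) (eta : environment) :
  bounded_fun (fun z => eta (y + z)).
Proof.
have [M [Mr H]] := field_bounded eta.
by exists M; split=> // t Mt z _; exact: H.
Qed.

Definition shift (y : 'rV[int]_d) (eta : environment) : environment :=
  BoundedField (shift_subproof y eta).

Definition stationary (P : probability environment R) : Prop :=
  forall (E : set environment) (y : 'rV[int]_d), measurable E ->
    P (shift y @` E) = P E.

Definition ergodic (P : probability environment R) : Prop :=
  forall E : set environment, measurable E ->
    E = \bigcap_(y in [set: 'rV[int]_d]) (shift y @` E) ->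
    P E = 0%E \/ P E = 1%E.

End Environment.

(* Main.v *)
(* If h is a function on the closure of W_n with lap h = eta_avg - eta in W_n and
   |h| <= a, then v_{avg_n} + h + a competes in the minimum defining v_n, so
   v_n <= v_{avg_n} + 2 a, and symmetrically.  It therefore suffices to solve
   lap h = eta_avg - eta, up to a uniformly small error, with |h| = o(n^2).

   Let A be the averaging operator of the lazy walk, so that lap = 4d (A - 1), let
   g = eta_avg - eta and S_j = sum_{k < j} A^k g.  Then, with N = n^2,
   h = - (4dN)^-1 sum_{j < N} S_j satisfies lap h = g - S_N / N, and everything
   reduces to max_{j <= n^2} |S_j(x)| = o(n^2), uniformly for |x| <= K n.

   At the origin, S_j / j -> 0 almost surely: a shift changes S_j by O(sqrt j) only,
   so {limsup S_j / j > e} is invariant, and if it had full probability then the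
   Hopf maximal ergodic lemma (in Garsia's form) would give E g >= e > 0.  Hence the
   set B of environments for which |S_j(0)| > e j for some j >= J has small
   probability.  The maximal lemma for the shifts along each coordinate axis, used
   one axis after the other, shows that outside an event of small probability every
   cube of side 2 l m centred in [-m, m]^d contains a point whose environment is not
   in B; the bound O(sqrt j) carries the estimate from there to the whole cube. *)
Require Import Defs.
From mathcomp Require Import all_boot all_order all_algebra.
From mathcomp Require Import all_classical all_reals all_analysis measurable_realfun.
From mathcomp Require Import zify ring lra.

Import Order.TTheory GRing.Theory Num.Theory.
Import numFieldNormedType.Exports.

Local Open Scope classical_set_scope.
Local Open Scope ring_scope.

Set Implicit Arguments.
Unset Strict Implicit.
Unset Printing Implicit Defensive.

Local Notation shift := Defs.shift.

Lemma exists_inv_succ_le (R : realType) (e : R) :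
  0 < e -> exists k : nat, k.+1%:R^-1 <= e.
Proof.
move=> e0; exists (Num.bound e^-1).
rewrite -[leRHS]invrK lef_pV2 ?posrE ?invr_gt0 ?ltr0n //.
by rewrite ltW // (lt_le_trans (archi_boundP _)) ?invr_ge0 ?(ltW e0) // ler_nat.
Qed.

(** * Averages over finitely many maps and their sums along the walk *)

Section Averaging.
Context (R : realType) (T : Type) (I : finType) (s : I -> T -> T).
Implicit Types f g u : T -> R.

(** The Markov operator of the walk that applies a uniformly chosen [s i] at each step; [psum f n x]
    is then the expected sum of [f] over the first [n] positions of the walk from [x]. *)
Definition mean f x : R := #|I|%:R^-1 * \sum_i f (s i x).

Definition psum f n x : R := \sum_(k < n) iter k mean f x.

Lemma psum0 f x : psum f 0 x = 0.
Proof. by rewrite /psum big_ord0. Qed.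

Lemma psumSr f n x : psum f n.+1 x = psum f n x + iter n mean f x.
Proof. by rewrite /psum big_ord_recr. Qed.

Lemma mean_le f g : (forall x, f x <= g x) -> forall x, mean f x <= mean g x.
Proof.
move=> fg x; rewrite /mean ler_wpM2l ?invr_ge0 ?ler0n //.
by apply: ler_sum => i _.
Qed.

Lemma meanD f g x : mean (fun y => f y + g y) x = mean f x + mean g x.
Proof. by rewrite /mean big_split mulrDr. Qed.

Lemma meanZ c f x : mean (fun y => c * f y) x = c * mean f x.
Proof. by rewrite /mean -mulr_sumr mulrCA. Qed.

Lemma psumS f n x : psum f n.+1 x = f x + mean (psum f n) x.
Proof.
elim: n x => [|n IH] x.
  rewrite psumSr psum0 add0r /= /mean big1 ?mulr0 ?addr0 // => i _.
  by rewrite psum0.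
rewrite psumSr IH /= -addrA -meanD; congr (_ + mean _ x).
by apply/funext => y; rewrite psumSr.
Qed.

Lemma psumZ c f n x : psum (fun y => c * f y) n x = c * psum f n x.
Proof.
elim: n x => [|n IH] x; first by rewrite !psum0 mulr0.
rewrite !psumS mulrDr -meanZ; congr (_ + mean _ x).
exact/funext.
Qed.

Hypothesis I0 : (0 < #|I|)%N.

Lemma mean_cst c x : mean (fun=> c) x = c.
Proof.
by rewrite /mean sumr_const -[c *+ _]mulr_natl mulKf // pnatr_eq0 -lt0n.
Qed.

Lemma mean_norm_le f M : (forall x, `|f x| <= M) -> forall x, `|mean f x| <= M.
Proof.
move=> fM x; have fM' y := fM y; rewrite ler_norml.
rewrite -{1}(mean_cst M x) -{2}(mean_cst M x) -mulN1r -meanZ.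
apply/andP; split; apply: mean_le => y; have := fM y;
  by rewrite ler_norml ?mulN1r => /andP[].
Qed.

Lemma iter_mean_norm_le f M n : (forall x, `|f x| <= M) ->
  forall x, `|iter n mean f x| <= M.
Proof. by move=> fM; elim: n => //= n IH; exact: mean_norm_le. Qed.

Lemma psum_norm_le f M n : (forall x, `|f x| <= M) ->
  forall x, `|psum f n x| <= n%:R * M.
Proof.
move=> fM x; apply: (le_trans (ler_norm_sum _ _ _)).
rewrite mulr_natl -[n in _ *+ n]card_ord -sumr_const.
by apply: ler_sum => k _; exact: iter_mean_norm_le.
Qed.

Lemma psumB_cst f c n x :
  psum (fun y => f y - c) n x = psum f n x - n%:R * c.
Proof.
elim: n x => [|n IH] x; first by rewrite !psum0 mul0r subr0.
rewrite !psumS.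
have -> : psum (fun y => f y - c) n = fun y => psum f n y + - (n%:R * c).
  exact/funext.
rewrite meanD mean_cst -natr1; ring.
Qed.

Lemma mean_sqrB f x : mean (fun y => f y ^+ 2) x - mean f x ^+ 2 =
  mean (fun y => (f y - mean f x) ^+ 2) x.
Proof.
set m := mean f x.
have -> : (fun y => (f y - m) ^+ 2) =
    fun y => f y ^+ 2 + (- (2 * m) * f y + m ^+ 2).
  by apply/funext => y; ring.
rewrite !meanD meanZ mean_cst -/m; ring.
Qed.

(** Only the terms of [i] and [j] are kept in the variance: for their deviations a and b from the
    mean, a^2 + b^2 >= (a - b)^2 / 2, since (a + b)^2 >= 0. *)
Lemma mean_variance_ge f x i j :
  (f (s i x) - f (s j x)) ^+ 2 / (2 * #|I|%:R) <=
  mean (fun y => f y ^+ 2) x - mean f x ^+ 2.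
Proof.
rewrite mean_sqrB; set m := mean f x; rewrite /mean.
have [->|ij] := eqVneq i j.
  rewrite subrr expr0n mul0r mulr_ge0 ?invr_ge0 ?ler0n //.
  by apply: sumr_ge0 => k _; exact: sqr_ge0.
rewrite invfM mulrA mulrC ler_wpM2l ?invr_ge0 ?ler0n //.
rewrite (bigD1 i) //= (bigD1 j) 1?eq_sym //= addrA.
apply: (@le_trans _ _ ((f (s i x) - m) ^+ 2 + (f (s j x) - m) ^+ 2)).
  have := sqr_ge0 (f (s i x) + f (s j x) - 2 * m); nra.
by rewrite lerDl; apply: sumr_ge0 => k _; exact: sqr_ge0.
Qed.

Hypothesis sC : forall i j x, s i (s j x) = s j (s i x).

Lemma mean_diff f i j x : mean (fun y => f (s i y) - f (s j y)) x =
  mean f (s i x) - mean f (s j x).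
Proof.
rewrite /mean -mulrBr -sumrB; congr (_ * _); apply: eq_bigr => k _.
by rewrite !(sC k).
Qed.

(* A discrete Bernstein estimate: the variance of one averaging step controls
   the square of the difference, and variances of successive steps telescope. *)
Lemma iter_mean_variance_ge f i j n x :
  n.+1%:R * (iter n mean f (s i x) - iter n mean f (s j x)) ^+ 2
    / (2 * #|I|%:R) <=
  iter n.+1 mean (fun y => f y ^+ 2) x - (iter n.+1 mean f x) ^+ 2.
Proof.
set c := 2 * #|I|%:R : R; have c0 : 0 <= c^-1.
  by rewrite invr_ge0 mulr_ge0 ?ler0n.
elim: n x => [|n IH] x; first by rewrite mul1r; exact: mean_variance_ge.
set u := iter n.+1 mean f.
pose D y := iter n mean f (s i y) - iter n mean f (s j y).
have Du y : mean D y = u (s i y) - u (s j y) by rewrite mean_diff.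
have h1 := mean_variance_ge u x i j.
have h2 : n.+1%:R / c * mean (fun y => D y ^+ 2) x <=
    mean (iter n.+1 mean (fun y => f y ^+ 2)) x - mean (fun y => u y ^+ 2) x.
  rewrite -mulN1r -!meanZ -meanD; apply: mean_le => y.
  by have := IH y; rewrite mulN1r mulrAC.
(* Jensen's inequality, read off the variance bound with equal indices, where its left side is
   zero. *)
have h3 : mean D x ^+ 2 <= mean (fun y => D y ^+ 2) x.
  rewrite -subr_ge0; apply: le_trans (mean_variance_ge D x i i).
  by rewrite subrr expr0n mul0r.
have {}h3 : n.+1%:R / c * mean D x ^+ 2 <= n.+1%:R / c * mean (fun y => D y ^+ 2) x.
  by apply: ler_wpM2l h3; rewrite mulr_ge0.
rewrite Du in h3; rewrite -/u.
have -> : iter n.+2 mean f x = mean u x by [].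
rewrite -[n.+2%:R]natr1.
have -> : iter n.+2 mean (fun y => f y ^+ 2) x =
  mean (iter n.+1 mean (fun y => f y ^+ 2)) x by [].
rewrite -/c in h1.
move: h1 h2 h3; lra.
Qed.

(** The right-hand side of [iter_mean_variance_ge] is at most M^2, so the factor [n.+1] on the left
    forces a decay like 1 / sqrt n. *)
Lemma iter_mean_diff_le f M i j n x : (forall y, `|f y| <= M) ->
  `|iter n mean f (s i x) - iter n mean f (s j x)| <=
  M * Num.sqrt (2 * #|I|%:R) / Num.sqrt n.+1%:R.
Proof.
move=> fM.
have M0 : 0 <= M by apply: le_trans (fM x).
have c0 : 0 < 2 * #|I|%:R :> R by rewrite mulr_gt0 ?ltr0n.
rewrite ler_pdivlMr ?sqrtr_gt0 ?ltr0n //.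
rewrite -(@ler_pXn2r _ 2) ?nnegrE ?mulr_ge0 ?sqrtr_ge0 //.
rewrite !exprMn !sqr_sqrtr ?(ltW c0) ?ler0n // real_normK ?num_real //.
rewrite -ler_pdivrMr // [_ * n.+1%:R]mulrC.
apply: (le_trans (iter_mean_variance_ge _ _ _ _ _)).
apply: (@le_trans _ _ (iter n.+1 mean (fun y => f y ^+ 2) x)).
  by rewrite lerBlDr lerDl sqr_ge0.
apply: (le_trans (ler_norm _)); apply: iter_mean_norm_le => y.
by rewrite normrX ler_pXn2r ?nnegrE.
Qed.

Lemma sum_inv_sqrt_le n :
  \sum_(k < n) (Num.sqrt k.+1%:R)^-1 <= 2 * Num.sqrt n%:R :> R.
Proof.
elim: n => [|n IH]; first by rewrite big_ord0 sqrtr0 mulr0.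
rewrite big_ord_recr /=.
set a := Num.sqrt n%:R in IH *; set b := Num.sqrt n.+1%:R.
have a0 : 0 <= a by rewrite sqrtr_ge0.
have b0 : 0 < b by rewrite sqrtr_gt0 ltr0n.
have ab : b ^+ 2 = a ^+ 2 + 1 by rewrite !sqr_sqrtr ?ler0n // natr1.
(* Since b^2 - a^2 = 1, the inequality 2 b (b - a) >= 1 amounts to (b - a)^2 >= 0. *)
suff : b^-1 <= 2 * (b - a) by move: IH; lra.
rewrite -[b^-1]mul1r ler_pdivrMr //; have := sqr_ge0 (b - a); nra.
Qed.

(** Summing the decay 1 / sqrt (k + 1) over [k < n] gives growth of order sqrt n only, which
    disappears when [psum f n] is divided by [n]. *)
Lemma psum_diff_le f M i j n x : (forall y, `|f y| <= M) ->
  `|psum f n (s i x) - psum f n (s j x)| <=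
  2 * M * Num.sqrt (2 * #|I|%:R) * Num.sqrt n%:R.
Proof.
move=> fM; rewrite /psum -sumrB; apply: (le_trans (ler_norm_sum _ _ _)).
apply: (@le_trans _ _ (\sum_(k < n) M * Num.sqrt (2 * #|I|%:R) *
    (Num.sqrt k.+1%:R)^-1)).
  by apply: ler_sum => k _; exact: iter_mean_diff_le.
have M0 : 0 <= M by apply: le_trans (fM x).
rewrite -mulr_sumr.
have -> : 2 * M * Num.sqrt (2 * #|I|%:R) * Num.sqrt n%:R =
  M * Num.sqrt (2 * #|I|%:R) * (2 * Num.sqrt n%:R) by ring.
by rewrite ler_wpM2l ?mulr_ge0 ?sqrtr_ge0 ?sum_inv_sqrt_le.
Qed.

End Averaging.

(** * Expectation of bounded measurable functions *)

Section Expectation.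
Context d (T : measurableType d) (R : realType) (P : probability T R).
Implicit Types (f g : T -> R) (A : set T).

Definition bounded_measurable f : Prop :=
  measurable_fun setT f /\ exists M : R, forall w, `|f w| <= M.

Local Notation bm := bounded_measurable.

Definition Ex f : R := \int[P]_w f w.

Lemma bm_integrable f : bm f -> P.-integrable setT (EFin \o f).
Proof.
move=> [mf [M fM]]; apply: measurable_bounded_integrable => //.
  exact: le_lt_trans (probability_le1 P measurableT) (ltry _).
exists M; split; [exact: num_real|move=> N MN x _ /=; exact: le_trans (ltW MN)].
Qed.

Lemma measurable_gt0 f : measurable_fun setT f -> measurable [set w | 0 < f w].
Proof.
move=> mf; rewrite (_ : [set _ | _] = f @^-1` `]0, +oo[%classic).
  by rewrite -[X in measurable X]setTI; exact: mf.
by apply/seteqP; split => w /=; rewrite in_itv /= andbT.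
Qed.

Lemma bm_cst c : bm (fun=> c).
Proof. by split; [exact: measurable_cst|exists `|c|]. Qed.

Lemma bmD f g : bm f -> bm g -> bm (fun w => f w + g w).
Proof.
move=> [mf [M fM]] [mg [N gN]]; split; first exact: measurable_funD.
by exists (M + N) => w; apply: (le_trans (ler_normD _ _)); rewrite lerD.
Qed.

Lemma bmM f g : bm f -> bm g -> bm (fun w => f w * g w).
Proof.
move=> [mf [M fM]] [mg [N gN]]; split; first exact: measurable_funM.
by exists (M * N) => w; rewrite normrM ler_pM.
Qed.

Lemma bm_max f g : bm f -> bm g -> bm (fun w => Num.max (f w) (g w)).
Proof.
move=> [mf [M fM]] [mg [N gN]]; split; first exact: measurable_maxr.
exists (Num.max M N) => w; rewrite le_max.
by case: (leP (f w) (g w)) => _; rewrite ?fM ?gN ?orbT.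
Qed.

Lemma bm_indic A : measurable A -> bm \1_A.
Proof.
move=> mA; split; first exact: measurable_indic.
by exists 1 => w; rewrite indicE ger0_norm // lern1 leq_b1.
Qed.

Lemma bm_sum (I : finType) (F : I -> T -> R) :
  (forall i, bm (F i)) -> bm (fun w => \sum_i F i w).
Proof.
move=> bF; rewrite -[X in bm X]/(fun w => \sum_(i <- index_enum I) F i w).
elim: index_enum => [|i s IH].
  rewrite (_ : (fun w => _) = fun=> 0); first exact: bm_cst.
  by apply/funext => w; rewrite big_nil.
rewrite (_ : (fun w => _) = fun w => F i w + \sum_(j <- s) F j w).
  exact: bmD.
by apply/funext => w; rewrite big_cons.
Qed.

Lemma ExD f g : bm f -> bm g -> Ex (fun w => f w + g w) = Ex f + Ex g.
Proof. by move=> bf bg; rewrite /Ex RintegralD //; exact: bm_integrable. Qed.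

Lemma ExZ c f : bm f -> Ex (fun w => c * f w) = c * Ex f.
Proof. by move=> bf; rewrite /Ex RintegralZl //; exact: bm_integrable. Qed.

Lemma Ex_cst c : Ex (fun=> c) = c.
Proof.
by rewrite /Ex Rintegral_cst //= probability_setT mulr1.
Qed.

Lemma Ex_le f g : bm f -> bm g -> (forall w, f w <= g w) -> Ex f <= Ex g.
Proof. by move=> bf bg fg; apply: le_Rintegral => //; exact: bm_integrable. Qed.

Lemma Ex_indic A : measurable A -> Ex \1_A = fine (P A).
Proof. by move=> mA; rewrite /Ex /Rintegral integral_indic // setIT. Qed.

Lemma Ex_sum (I : finType) (F : I -> T -> R) :
  (forall i, bm (F i)) -> Ex (fun w => \sum_i F i w) = \sum_i Ex (F i).
Proof.
move=> bF; rewrite -[LHS]/(Ex (fun w => \sum_(i <- index_enum I) F i w)).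
suff [_ ->] : bm (fun w => \sum_(i <- index_enum I) F i w) /\
    Ex (fun w => \sum_(i <- index_enum I) F i w) =
    \sum_(i <- index_enum I) Ex (F i) by [].
elim: index_enum => [|i s [bIH IH]].
  rewrite (_ : (fun w => _) = fun=> 0); last first.
    by apply/funext => w; rewrite big_nil.
  by rewrite big_nil Ex_cst; split=> //; exact: bm_cst.
rewrite (_ : (fun w => _) = fun w => F i w + \sum_(j <- s) F j w); last first.
  by apply/funext => w; rewrite big_cons.
by split; [exact: bmD|rewrite ExD // IH big_cons].
Qed.

Lemma Ex_preserving f (s : T -> T) : measurable_fun setT s ->
  (forall A, measurable A -> P (s @^-1` A) = P A) -> bm f ->
  Ex (f \o s) = Ex f.
Proof.
move=> ms sP bf; rewrite /Ex /Rintegral; congr fine.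
have mf : measurable_fun setT (EFin \o f) by apply/measurable_EFinP; case: bf.
have bfs : bm (f \o s).
  case: bf => mf' [M fM]; split; first exact: measurableT_comp.
  by exists M => w; exact: fM.
have := @integral_pushforward _ _ _ _ _ _ ms P setT (EFin \o f) mf.
rewrite preimage_setT => /(_ (bm_integrable bfs) measurableT) /= <-.
by apply: eq_measure_integral => A mA _; exact: sP.
Qed.

End Expectation.

(** * The maximal ergodic lemma for averages of measure-preserving maps *)

Section MaximalErgodic.
Context d (T : measurableType d) (R : realType) (P : probability T R).
Context (I : finType) (s : I -> T -> T).
Hypothesis ms : forall i, measurable_fun setT (s i).
Hypothesis sP : forall i A, measurable A -> P (s i @^-1` A) = P A.
Hypothesis I0 : (0 < #|I|)%N.
Implicit Types (f g : T -> R) (A : set T).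

Local Notation bm := (@bounded_measurable _ T R).
Local Notation Ex := (Ex P).
Local Notation mean := (@mean R T I s).
Local Notation psum := (@psum R T I s).

Lemma bm_comp f i : bm f -> bm (f \o s i).
Proof.
case=> mf [M fM]; split; first exact: measurableT_comp.
by exists M => w; exact: fM.
Qed.

Lemma bm_mean f : bm f -> bm (mean f).
Proof.
move=> bf; apply: (bmM (bm_cst _ _)); apply: bm_sum => i.
exact: (bm_comp i bf).
Qed.

Lemma Ex_mean f : bm f -> Ex (mean f) = Ex f.
Proof.
move=> bf; rewrite [LHS]ExZ; last by apply: bm_sum => i; exact: (bm_comp i bf).
rewrite Ex_sum; last by move=> i; exact: (bm_comp i bf).
rewrite (eq_bigr (fun=> Ex f)); last first.
  by move=> i _; exact: (Ex_preserving (ms i) (sP i) bf).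
by rewrite sumr_const -[Ex f *+ _]mulr_natl mulKf // pnatr_eq0 -lt0n.
Qed.

Lemma bm_psum f n : bm f -> bm (psum f n).
Proof.
move=> bf; elim: n => [|n IH].
  by rewrite (_ : psum f 0 = fun=> 0); [exact: bm_cst|apply/funext => w; rewrite psum0].
rewrite (_ : psum f n.+1 = fun w => f w + mean (psum f n) w).
  by apply: bmD => //; exact: bm_mean.
by apply/funext => w; rewrite psumS.
Qed.

(** The base value 0 is [psum f 0], so the maximum is never negative and is positive exactly on
    [exceed f n]. *)
Fixpoint maxpsum f n w : R :=
  if n is m.+1 then Num.max (maxpsum f m w) (psum f m.+1 w) else 0.

Lemma bm_maxpsum f n : bm f -> bm (maxpsum f n).
Proof.
move=> bf; elim: n => [|n IH]; first exact: bm_cst.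
by apply: bm_max => //; exact: bm_psum.
Qed.

Lemma maxpsum_ge0 f n w : 0 <= maxpsum f n w.
Proof. by elim: n => //= n IH; rewrite le_max IH. Qed.

Lemma le_maxpsum f n j w : (j <= n)%N -> psum f j w <= maxpsum f n w.
Proof.
elim: n => [|n IH]; first by rewrite leqn0 => /eqP ->; rewrite psum0.
rewrite leq_eqVlt => /predU1P[->|]; first by rewrite /= le_max lexx orbT.
by move=> /IH jn; rewrite /= le_max jn.
Qed.

Lemma maxpsum_gt0 f n w : 0 < maxpsum f n w ->
  exists2 j, (j < n)%N & maxpsum f n w = psum f j.+1 w.
Proof.
elim: n => [|n IH]; first by rewrite ltxx.
rewrite /=; case: (ltP (maxpsum f n w)) => h; first by move=> _; exists n.
by move=> /IH[j jn e]; exists j => //; rewrite ltnS ltnW.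
Qed.

Definition exceed f n : set T :=
  [set w | exists2 j, (j <= n)%N & 0 < psum f j w].

Lemma exceedE f n : exceed f n = [set w | 0 < maxpsum f n w].
Proof.
apply/seteqP; split => w /=.
  by move=> [j jn] /lt_le_trans; apply; exact: le_maxpsum.
by move=> h; have [j jn e] := maxpsum_gt0 h; exists j.+1; rewrite -?e.
Qed.

Lemma measurable_exceed f n : bm f -> measurable (exceed f n).
Proof.
by move=> bf; rewrite exceedE; apply: measurable_gt0; have [] := bm_maxpsum n bf.
Qed.

(* Garsia's argument: where the running maximum [m] is positive, [m] is some
   [psum f j.+1 = f + mean (psum f j)], hence at most [f + mean m]. *)
Lemma maximal_ergodic f n : bm f -> 0 <= Ex (fun w => f w * \1_(exceed f n) w).
Proof.
move=> bf; set m := maxpsum f n; have bmm : bm m by exact: bm_maxpsum.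
(* Zero becomes the expectation of m - mean m, because [mean] preserves [Ex]; the remaining
   inequality holds pointwise. *)
have -> : 0 = Ex (fun w => m w + -1 * mean m w).
  rewrite ExD //; last by apply: bmM; [exact: bm_cst|exact: bm_mean].
  by rewrite ExZ ?Ex_mean //; [ring|exact: bm_mean].
have bi : bm \1_(exceed f n) by apply: bm_indic; exact: measurable_exceed.
have bmm' := bm_mean bmm.
apply: Ex_le.
- by apply: bmD => //; apply: bmM => //; exact: bm_cst.
- exact: bmM.
move=> w; rewrite indicE exceedE; case: (pselect (0 < m w)) => h.
  rewrite mem_set // mulr1; have [j jn] := maxpsum_gt0 h.
  rewrite -/m psumS => ->.
  have : mean (psum f j) w <= mean m w.
    by apply: mean_le => v; apply: le_maxpsum; exact: ltnW.
  lra.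
rewrite memNset // mulr0; have m0 : m w = 0.
  by apply/eqP; rewrite eq_le maxpsum_ge0 leNgt andbT; apply/negP.
rewrite m0.
have : 0 <= mean m w.
  by rewrite -(mean_cst s I0 0 w); apply: mean_le => v; exact: maxpsum_ge0.
lra.
Qed.

End MaximalErgodic.

(** * A weak-type inequality and a criterion for a nonnegative expectation *)

Section MaximalErgodicConsequences.
Context d (T : measurableType d) (R : realType) (P : probability T R).
Context (I : finType) (s : I -> T -> T).
Hypothesis ms : forall i, measurable_fun setT (s i).
Hypothesis sP : forall i A, measurable A -> P (s i @^-1` A) = P A.
Hypothesis I0 : (0 < #|I|)%N.
Implicit Types (f g : T -> R) (A B : set T).

Local Notation bm := (@bounded_measurable _ T R).
Local Notation Ex := (Ex P).
Local Notation mean := (@mean R T I s).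
Local Notation psum := (@psum R T I s).
Local Notation exceed := (@exceed _ T R I s).

Lemma nondecreasing_exceed f : nondecreasing_seq (exceed f).
Proof.
move=> m n mn; apply/subsetPset => w [j jm h]; exists j => //.
exact: leq_trans mn.
Qed.

Lemma cvg_exceed f : bm f ->
  (P (exceed f n))%E @[n --> \oo] --> P (\bigcup_n exceed f n).
Proof.
move=> bf; have mE n := measurable_exceed ms n bf.
apply: nondecreasing_cvg_mu => //; first exact: bigcup_measurable.
exact: nondecreasing_exceed.
Qed.

Lemma measurable_psum_gt f c : bm f ->
  measurable [set w | exists n, n%:R * c < psum f n w].
Proof.
move=> bf; rewrite (_ : [set _ | _] = \bigcup_n [set w | 0 < psum f n w - n%:R * c]).
  apply: bigcup_measurable => n _.
  have [m _] : bm (fun w => psum f n w + - (n%:R * c)).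
    by apply: bmD; [exact: bm_psum|exact: bm_cst].
  exact: measurable_gt0.
apply/seteqP; split => w /= [n]; first by exists n => //=; rewrite subr_gt0.
by move=> _; rewrite /= subr_gt0; exists n.
Qed.

Lemma bigcup_exceed f c :
  \bigcup_n exceed (fun w => f w - c) n =
  [set w | exists n, n%:R * c < psum f n w].
Proof.
apply/seteqP; split => w /=.
  by move=> [n _ [j _]]; rewrite psumB_cst // subr_gt0; exists j.
by move=> [n h]; exists n => //; exists n => //; rewrite psumB_cst // subr_gt0.
Qed.

(** The maximal lemma for 1_B - c bounds c P([exceed f n]) by the probability of the part of [B]
    inside [exceed f n], hence by P(B); then [n] tends to infinity. *)
Lemma ergodic_maximal_inequality B (c : R) : measurable B -> 0 < c ->
  (c%:E * P [set w | exists n, (n%:R * c < psum \1_B n w)%R] <= P B)%E.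
Proof.
move=> mB c0; rewrite -bigcup_exceed; set f := fun w => \1_B w - c.
have b1 : bm \1_B by exact: bm_indic.
have bf : bm f by apply: bmD => //; exact: bm_cst.
have le n : (P (exceed f n) <= (c^-1)%:E * P B)%E.
  have mE := measurable_exceed ms n bf.
  have bE : bm \1_(exceed f n) by exact: bm_indic.
  have := maximal_ergodic ms sP I0 n bf.
  have -> : (fun w => f w * \1_(exceed f n) w) =
    (fun w => \1_B w * \1_(exceed f n) w + - c * \1_(exceed f n) w).
    by apply/funext => w; rewrite /f; ring.
  rewrite ExD; [|exact: bmM|by apply: bmM => //; exact: bm_cst].
  rewrite ExZ // Ex_indic // => h.
  have h1 : Ex (fun w => \1_B w * \1_(exceed f n) w) <= fine (P B).
    rewrite -Ex_indic //; apply: Ex_le => //; first exact: bmM.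
    by move=> w; rewrite ler_piMr ?indicE ?ler0n // lern1 leq_b1.
  have f1 : P (exceed f n) \is a fin_num by exact: fin_num_measure.
  have f2 : P B \is a fin_num by exact: fin_num_measure.
  rewrite -(fineK f1) -(fineK f2) -EFinM lee_fin mulrC ler_pdivlMr //.
  by rewrite mulrC; lra.
have : (P (\bigcup_n exceed f n) <= (c^-1)%:E * P B)%E.
  have cv := cvg_exceed bf.
  rewrite -(cvg_lim (@ereal_hausdorff R) cv).
  apply: lime_le; first by apply/cvg_ex; exists (P (\bigcup_n exceed f n)).
  by near=> n.
by rewrite muleC lee_pdivlMr // muleC.
Unshelve. all: by end_near.
Qed.

(** By the maximal lemma E f is at least the expectation of [f] off [exceed f n], hence at least -M
    times the probability of that complement, which tends to 0. *)
Lemma Ex_ge0_of_psum_gt0 f : bm f ->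
  P (\bigcup_n exceed f n) = 1%E -> 0 <= Ex f.
Proof.
move=> bf P1; have [M fM] := bf.2.
have le n : - M * (1 - fine (P (exceed f n))) <= Ex f.
  have mE := measurable_exceed ms n bf.
  have bE : bm \1_(exceed f n) by exact: bm_indic.
  rewrite -Ex_indic // -{1}(Ex_cst P 1).
  have bc : bm (fun w => 1 + -1 * \1_(exceed f n) w).
    by apply: bmD (bm_cst _ _) (bmM (bm_cst _ _) bE).
  have -> : Ex (fun=> 1) - Ex \1_(exceed f n) =
      Ex (fun w => 1 + -1 * \1_(exceed f n) w).
    rewrite ExD; [|exact: bm_cst|by apply: bmM => //; exact: bm_cst].
    by rewrite ExZ // mulN1r.
  rewrite -ExZ //.
  apply: (@le_trans _ _ (Ex (fun w => f w * (1 + -1 * \1_(exceed f n) w)))).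
    apply: Ex_le; [by apply: bmM => //; exact: bm_cst|exact: bmM|].
    move=> w; apply: ler_wpM2r; last first.
      by have := fM w; rewrite ler_norml => /andP[].
    rewrite mulN1r subr_ge0 indicE lern1; exact: leq_b1.
  have -> : (fun w => f w * (1 + -1 * \1_(exceed f n) w)) =
      (fun w => f w + -1 * (f w * \1_(exceed f n) w)).
    by apply/funext => w; ring.
  rewrite ExD //; last by apply: bmM; [exact: bm_cst|exact: bmM].
  rewrite ExZ; last exact: bmM.
  by have := maximal_ergodic ms sP I0 n bf; lra.
have cv : fine (P (exceed f n)) @[n --> \oo] --> (1 : R).
  by apply: fine_cvg; rewrite -P1; exact: cvg_exceed.
have cv' : - M * (1 - fine (P (exceed f n))) @[n --> \oo] --> (0 : R).
  rewrite -(mulr0 (- M)) -(subrr (1 : R)).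
  apply: cvgM; first exact: cvg_cst.
  by apply: cvgB => //; exact: cvg_cst.
rewrite -(cvg_lim (@Rhausdorff R) cv').
apply: limr_le; first by apply/cvg_ex; exists 0.
by near=> n.
Unshelve. all: by end_near.
Qed.

End MaximalErgodicConsequences.

(** * Shifts of the environment *)

Section Shift.
Context (R : realType) (d : nat).
Local Notation env := (environment R d).
Implicit Types (w : env) (x y z : 'rV[int]_d) (E : set env).

Lemma environment_eq w1 w2 : (forall x, w1 x = w2 x) -> w1 = w2.
Proof.
case: w1 w2 => [f bf] [g bg] /= /funext fg; subst g.
by congr BoundedField; exact: Prop_irrelevance.
Qed.

Lemma field_shift_shift y z w : shift z (shift y w) = shift (y + z) w.
Proof. by apply: environment_eq => x /=; rewrite addrA. Qed.

Lemma field_shift0 w : shift 0 w = w.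
Proof. by apply: environment_eq => x /=; rewrite add0r. Qed.

(** Shifts are invertible, so the images in [stationary] and [ergodic] can be handled as preimages
    of measurable sets. *)
Lemma shift_imageE y E : shift y @` E = shift (- y) @^-1` E.
Proof.
apply/seteqP; split => w /=.
  by move=> [v Ev <-]; rewrite field_shift_shift subrr field_shift0.
by move=> Ew; exists (shift (- y) w); rewrite // field_shift_shift addNr field_shift0.
Qed.

Lemma measurable_coordinate x : measurable_fun setT (fun w : env => w x).
Proof.
move=> _ A mA; rewrite setTI; apply: sub_sigma_algebra.
by exists x => //; exists A => //; rewrite setTI.
Qed.

Lemma measurable_shift y : measurable_fun setT (shift y : env -> env).
Proof.
apply: (@measurability _ _ env env setT _ (@coordinate_events R d)) => //.
move=> _ [_ [x _ [A mA <-]] <-]; rewrite !setTI.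
rewrite (_ : _ @^-1` _ = (fun w : env => w (y + x)) @^-1` A) //.
by rewrite -[X in measurable X]setTI; exact: measurable_coordinate.
Qed.

Context (P : probability env R) (Pstat : stationary P).

Lemma stationary_preimage y E : measurable E -> P (shift y @^-1` E) = P E.
Proof. by move=> mE; rewrite -[y]opprK -shift_imageE Pstat. Qed.

End Shift.

(** * The lazy walk on the lattice and its relation to the Laplacian *)

Section LazyWalk.
Context (R : realType) (d : nat) (d0 : (0 < d)%N).
Local Notation env := (environment R d).
Implicit Types (w : env) (x y z : 'rV[int]_d) (E : set env) (f : env -> R).

Definition lazy_index : finType := (('I_d * bool) * bool)%type.

(* Half of the indices do not move, so that the difference between a point and
   one of its neighbours is a difference between two indices of the same
   averaging step, as [psum_diff_le] requires; for the simple walk, which has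
   period 2, that estimate fails. *)
Definition lazy_step (i : lazy_index) : 'rV[int]_d :=
  if i.2 then lstep i.1 else 0.

Definition lazy_shift (i : lazy_index) (w : env) : env := shift (lazy_step i) w.

Lemma lazy_shiftC i j w :
  lazy_shift i (lazy_shift j w) = lazy_shift j (lazy_shift i w).
Proof. by rewrite /lazy_shift !field_shift_shift addrC. Qed.

Lemma card_lazy_index : #|{: lazy_index}| = (4 * d)%N.
Proof. by rewrite !card_prod card_ord card_bool; lia. Qed.

Lemma lazy_index_gt0 : (0 < #|{: lazy_index}|)%N.
Proof. by rewrite card_lazy_index muln_gt0. Qed.

Definition norm1 z : nat := (\sum_i absz (z 0%R i))%N.

Lemma norm1D_le_lipschitz (u : 'rV[int]_d -> R) l :
  (forall x p, `|u (x + lstep p) - u x| <= l) ->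
  forall z x, `|u (x + z) - u x| <= l * (norm1 z)%:R.
Proof.
move=> ul z; move: {-1}(norm1 z) (erefl (norm1 z)) => n.
elim: n z => [|n IH] z zn x.
  suff -> : z = 0 by rewrite addr0 subrr normr0 mulr0.
  apply/rowP => i; rewrite mxE; apply/eqP; rewrite -absz_eq0.
  by move: zn => /eqP; rewrite sum_nat_eq0 => /forallP /(_ i).
have [i zi] : exists i, z 0 i != 0.
  apply/not_existsP => H; move: zn; rewrite /norm1 big1 // => i _.
  by have /negP/negPn/eqP -> := H i.
(* [lstep p] points along axis [i] with the sign of [z 0 i], so subtracting it moves that coordinate
   one step towards 0. *)
pose p := (i, z 0 i < 0).
have z'n : norm1 (z - lstep p) = n.
  have rest : (\sum_(j | j != i) absz ((z - lstep p)%R 0%R j) =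
      \sum_(j | j != i) absz (z 0%R j))%N.
    apply: eq_bigr => j ji; rewrite !mxE eqxx (negbTE ji) /=.
    by congr absz; rewrite mulr0 subr0.
  move: zn; rewrite /norm1 !(bigD1 (P := xpredT) i) //= rest.
  set r := (\sum_(j | _) _)%N; rewrite !mxE !eqxx /= mulr1.
  by move: zi; case: (ltrP (z 0 i) 0) => h /=; rewrite ?expr0 ?expr1; lia.
rewrite -natr1 mulrDr mulr1.
have -> : u (x + z) - u x =
  (u (x + lstep p + (z - lstep p)) - u (x + lstep p)) + (u (x + lstep p) - u x).
  have -> : x + lstep p + (z - lstep p) = x + z by rewrite addrACA subrr addr0.
  by rewrite addrA subrK.
apply: (le_trans (ler_normD _ _)); apply: lerD => //; exact: IH.
Qed.

Local Notation psum := (psum lazy_shift).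

(** The constant of [psum_diff_le] for the 4 d indices of the lazy walk: one lattice step changes
    [psum f n] by at most [lip_const M] times sqrt n. *)
Definition lip_const (M : R) : R := 2 * M * Num.sqrt (2 * (4 * d)%:R).

Lemma psum_shift_diff_le f M n z w : (forall v, `|f v| <= M) ->
  `|psum f n (shift z w) - psum f n w| <=
  lip_const M * Num.sqrt n%:R * (norm1 z)%:R.
Proof.
move=> fM.
have := @norm1D_le_lipschitz (fun x => psum f n (shift x w))
  (lip_const M * Num.sqrt n%:R).
move=> /(_ _ z 0); rewrite add0r field_shift0; apply => x p.
have := psum_diff_le lazy_index_gt0 lazy_shiftC (p, true) (p, false) n (shift x w) fM.
by rewrite /lazy_shift /lazy_step /= field_shift0 field_shift_shift card_lazy_index.
Qed.

(** Of the 4 d indices half move to a neighbour and half stay, so the sum over them is the Laplacian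
    plus 4 d times the value at the point. *)
Lemma laplacian_mean f w x :
  laplacian (fun y => f (shift y w)) x =
  (4 * d)%:R * (mean lazy_shift f (shift x w) - f (shift x w)).
Proof.
rewrite laplacian_lstepE /mean card_lazy_index.
have -> : \sum_i f (lazy_shift i (shift x w)) =
    \sum_(p : 'I_d * bool) ((f (shift (x + lstep p) w) - f (shift x w)) +
      (f (shift x w) + f (shift x w))).
  rewrite (eq_bigr (fun i : lazy_index => f (lazy_shift (i.1, i.2) (shift x w)))).
    rewrite -(pair_bigA _ (fun p b => f (lazy_shift (p, b) (shift x w)))) /=.
    apply: eq_bigr => p _.
    by rewrite big_bool /lazy_shift /lazy_step /= field_shift0 field_shift_shift; ring.
  by case.
rewrite [in RHS]big_split /= sumr_const card_prod card_ord card_bool.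
have d0' : (4 * d)%:R != 0 :> R by rewrite pnatr_eq0 muln_eq0 -lt0n d0.
rewrite mulrBr mulVKf // -[_ *+ (d * 2)%N]mulr_natl !natrM; ring.
Qed.

End LazyWalk.

(** * Vanishing of [psum g n / n] at the origin under ergodicity *)

Section Ergodic.
Context (R : realType) (d : nat) (d0 : (0 < d)%N).
Local Notation env := (environment R d).
Context (P : probability env R) (Pstat : stationary P) (Perg : ergodic P).
Implicit Types (w : env) (x y z : 'rV[int]_d) (E : set env) (g : env -> R) (e t : R).

Local Notation bm := (@bounded_measurable _ env R).
Local Notation Ex := (Ex P).
Local Notation psum := (psum (@lazy_shift R d)).

Let measurable_lazy_shift i : measurable_fun setT (@lazy_shift R d i).
Proof. exact: measurable_shift. Qed.

Let lazy_shift_preserving i E : measurable E ->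
  P (@lazy_shift R d i @^-1` E) = P E.
Proof. exact: stationary_preimage. Qed.

(** Shifts form a group, so stability under every shift already puts [E] inside each shifted image;
    the image under [y = 0] gives the reverse inclusion. *)
Lemma ergodic_invariant E : measurable E ->
  (forall y w, E w -> E (shift y w)) -> P E = 0%E \/ P E = 1%E.
Proof.
move=> mE Einv; apply: Perg => //; apply/seteqP; split => w Ew.
  move=> y _; exists (shift (- y) w); first exact: Einv.
  by rewrite field_shift_shift addNr field_shift0.
by have [v Ev <-] := Ew 0 I; rewrite field_shift0.
Qed.

(** The event that the limsup of [psum g n / n] exceeds [e]. The explicit margin 1 / (k + 1) leaves
    room for the change caused by a shift. *)
Definition limsup_gt g (e : R) : set env :=
  [set w | exists k, forall m, exists2 n, (m <= n)%N &
    n%:R * (e + k.+1%:R^-1) < psum g n w].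

Lemma measurable_limsup_gt g e : bm g -> measurable (limsup_gt g e).
Proof.
move=> bg.
rewrite (_ : limsup_gt g e = \bigcup_k \bigcap_m \bigcup_(n in [set n | (m <= n)%N])
    [set w | 0 < psum g n w - n%:R * (e + k.+1%:R^-1)]); last first.
  apply/seteqP; split => w.
    move=> [k wk]; exists k => // m _; have [n mn h] := wk m.
    by exists n => //=; rewrite subr_gt0.
  move=> [k _ wk]; exists k => m; have [n mn h] := wk m I.
  by exists n => //; move: h; rewrite /= subr_gt0.
apply: bigcup_measurable => k _; apply: bigcap_measurable => // m _.
apply: bigcup_measurable => n _; set c := _ * _.
have [mf _] : bm (fun w => psum g n w + - c).
  by apply: bmD; [exact: bm_psum|exact: bm_cst].
exact: measurable_gt0.
Qed.

(* By [psum_shift_diff_le] a shift changes [psum g n] by [O(sqrt n)] only. *)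
Lemma limsup_gt_invariant g e y w : bm g -> limsup_gt g e w ->
  limsup_gt g e (shift y w).
Proof.
move=> [_ [M gM]] [k wk]; exists k.+1 => m.
(* Passing from margin k to k + 1 gains [a * n], which exceeds the loss C sqrt n as soon as n >= (C
   / a)^2. *)
pose a : R := k.+1%:R^-1 - k.+2%:R^-1.
have a0 : 0 < a by rewrite subr_gt0 ltf_pV2 ?posrE ?ltr0n // ltr_nat.
pose C := lip_const d M * (norm1 y)%:R.
have M0 : 0 <= M by apply: le_trans (gM w).
have C0 : 0 <= C by rewrite !mulr_ge0 ?sqrtr_ge0.
have [N HN] : exists N : nat, (C / a) ^+ 2 <= N%:R.
  exists (Num.bound ((C / a) ^+ 2)); apply/ltW/archi_boundP; exact: sqr_ge0.
have [n mn h] := wk (maxn m N.+1); exists n.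
  by apply: leq_trans mn; exact: leq_maxl.
have nN : (N < n)%N by apply: leq_trans mn; exact: leq_maxr.
have := psum_shift_diff_le d0 n y w gM; rewrite ler_norml => /andP[h1 _].
have h2 : lip_const d M * Num.sqrt n%:R * (norm1 y)%:R <= a * n%:R.
  rewrite mulrAC -/C; set r := Num.sqrt n%:R.
  have r2 : r ^+ 2 = n%:R by rewrite sqr_sqrtr ?ler0n.
  rewrite -r2 expr2 mulrA ler_wpM2r ?sqrtr_ge0 //.
  rewrite mulrC -ler_pdivrMr // -(@ler_pXn2r _ 2) ?nnegrE;
    rewrite ?sqrtr_ge0 ?divr_ge0 ?(ltW a0) //.
  by rewrite r2; apply: (le_trans HN); rewrite ler_nat ltnW.
have -> : n%:R * (e + k.+2%:R^-1) = n%:R * (e + k.+1%:R^-1) - a * n%:R.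
  by rewrite /a; ring.
apply: (@lt_le_trans _ _ (psum g n w - a * n%:R)); first by rewrite ltrD2r.
by rewrite addrC -lerBrDr (le_trans _ h1) // lerN2.
Qed.

Lemma limsup_gt_null g e : bm g -> Ex g = 0 -> 0 < e -> P (limsup_gt g e) = 0%E.
Proof.
move=> bg g0 e0.
have mU := measurable_limsup_gt e bg.
have [//|P1] := ergodic_invariant mU (fun y w => limsup_gt_invariant y bg).
pose f w := g w - e; have bf : bm f by apply: bmD => //; exact: bm_cst.
suff : 0 <= Ex f.
  have -> : Ex f = Ex g + Ex (fun=> - e) by exact: ExD bg (bm_cst _ _).
  by rewrite g0 Ex_cst add0r oppr_ge0 leNgt e0.
apply: (Ex_ge0_of_psum_gt0 measurable_lazy_shift lazy_shift_preserving
  (lazy_index_gt0 d0)) => //.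
apply/eqP; rewrite eq_le; apply/andP; split.
  apply: probability_le1; apply: bigcup_measurable => n _.
  exact: measurable_exceed.
rewrite -P1; apply: le_measure; rewrite ?inE //.
  by apply: bigcup_measurable => n _; exact: measurable_exceed.
rewrite bigcup_exceed; last exact: lazy_index_gt0.
move=> w [k wk]; have [n _ h] := wk 0%N; exists n; apply: le_lt_trans h.
by rewrite ler_wpM2l // lerDl invr_ge0.
Qed.

Definition late_exceed g (e : R) J : set env :=
  [set w | exists2 j, (J <= j)%N & j%:R * e < `|psum g j w|].

Lemma measurable_late_exceed g e J : bm g -> measurable (late_exceed g e J).
Proof.
move=> bg.
rewrite (_ : late_exceed g e J = \bigcup_(j in [set j | (J <= j)%N])
    [set w | 0 < `|psum g j w| - j%:R * e]); last first.
  apply/seteqP; split => w [j Jj h]; exists j => //; move: h;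
    by rewrite /= subr_gt0.
apply: bigcup_measurable => j _; set c := _ * _.
have [mf _] : bm (psum g j) by exact: bm_psum.
apply: measurable_gt0; apply: measurable_funB; first exact: measurableT_comp.
exact: measurable_cst.
Qed.

(** The events decrease in [J], and their intersection lies in the union of the null events
    [limsup_gt] for [g] and for -g at level e / 2; the other half of [e] pays for the margin.
    Continuity from above concludes. *)
Lemma late_exceed_small g e t : bm g -> Ex g = 0 -> 0 < e -> 0 < t ->
  exists J, (P (late_exceed g e J) < t%:E)%E.
Proof.
move=> bg g0 e0 t0.
have mL J := measurable_late_exceed e J bg.
have e20 : 0 < e / 2 by lra.
pose g' w := -1 * g w; have bg' : bm g' by apply: bmM => //; exact: bm_cst.
have Eg' : Ex g' = 0 by rewrite /g' ExZ // g0 mulr0.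
have cap0 : P (\bigcap_J late_exceed g e J) = 0%E.
  apply/eqP; rewrite eq_le measure_ge0 andbT.
  have mU := measurable_limsup_gt (e / 2) bg.
  have mU' := measurable_limsup_gt (e / 2) bg'.
  apply: (@le_trans _ _ (P (limsup_gt g (e / 2) `|` limsup_gt g' (e / 2)))).
    apply: le_measure; rewrite ?inE //; [exact: bigcap_measurable|exact: measurableU|].
    move=> w wL; apply: contrapT => /not_orP[n1 n2].
    have [k hk] := exists_inv_succ_le e20.
    have bnd f : ~ limsup_gt f (e / 2) w -> exists m, forall n, (m <= n)%N ->
        psum f n w <= n%:R * e.
      move=> H; apply: contrapT => H'; apply: H; exists k => m.
      apply: contrapT => H2; apply: H'; exists m => n mn.
      rewrite leNgt; apply/negP => h; apply: H2; exists n => //.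
      by apply: le_lt_trans h; rewrite ler_wpM2l // [leRHS]splitr lerD2l.
    have [m1 h1] := bnd _ n1; have [m2 h2] := bnd _ n2.
    have [j mj hj] := wL (maxn m1 m2) I.
    have := h1 j (leq_trans (leq_maxl _ _) mj).
    have := h2 j (leq_trans (leq_maxr _ _) mj).
    rewrite psumZ mulN1r => h3 h4.
    by move: hj; rewrite ltNge ler_norml h4 andbT lerNl h3.
  by rewrite (le_trans (measureU2 _ _ _)) //= !limsup_gt_null // adde0.
have cv : (P \o late_exceed g e) @ \oo --> 0%E.
  rewrite -cap0; apply: nonincreasing_cvg_mu => //.
  - by rewrite (le_lt_trans (probability_le1 _ _)) // ltry.
  - exact: bigcap_measurable.
  - move=> J K JK; apply/subsetPset => w [j Kj h]; exists j => //.
    exact: leq_trans Kj.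
have /fine_cvgP[_ /cvgrPdist_lt /(_ _ t0) [J _ /(_ J (leqnn J)) HJ]] := cv.
exists J; rewrite -[X in (X < _)%E]fineK ?fin_num_measure // lte_fin.
by move: HJ; rewrite /= sub0r normrN; apply: le_lt_trans; exact: ler_norm.
Qed.

End Ergodic.

(** * Good points in every box, and the uniform bound on [psum] *)

Section Density.
Context (R : realType) (d : nat) (d0 : (0 < d)%N).
Local Notation env := (environment R d).
Context (P : probability env R) (Pstat : stationary P).
Implicit Types (w : env) (x y z v : 'rV[int]_d) (B : set env) (l : R).

Local Notation bm := (@bounded_measurable _ env R).

(** Over a one-point index type [psum] is the Birkhoff sum of a single shift, so the maximal
    inequality applies along one direction. *)
Lemma iter_mean_unit v (f : env -> R) k w :
  iter k (mean (fun _ : unit => shift v)) f w = f (shift (v *+ k) w).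
Proof.
elim: k w => [|k IH] w; first by rewrite mulr0n field_shift0.
rewrite iterS {1}/mean card_unit invr1 mul1r sumr_const card_unit mulr1n.
by rewrite IH field_shift_shift -mulrS.
Qed.

(** [B1] is the event that [B] has frequency above l / 3 in some initial segment of the ray. If all
    points from [t] to [t] + l n were in [B], they would number more than l n among at most 3 n
    points, since [t], l n and 1 are each at most [n]. *)
Lemma ray_density v B l : measurable B -> 0 < l -> l <= 1 ->
  exists B1, [/\ measurable B1, ((l / 3)%:E * P B1 <= P B)%E &
    forall w, ~ B1 w -> forall n t, (0 < n)%N -> (t <= n)%N ->
      exists j, [/\ (t <= j)%N, j%:R <= t%:R + l * n%:R &
        ~ B (shift (v *+ j) w)]].
Proof.
move=> mB l0 l1.
have ms (i : unit) : measurable_fun setT (shift v : env -> env).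
  exact: measurable_shift.
have sP (i : unit) A : measurable A -> P (shift v @^-1` A) = P A.
  exact: stationary_preimage.
have I0 : (0 < #|{: unit}|)%N by rewrite card_unit.
have c0 : 0 < l / 3 by lra.
exists [set w | exists n, n%:R * (l / 3) < psum (fun _ : unit => shift v) \1_B n w].
split.
- by apply: measurable_psum_gt => //; exact: bm_indic.
- exact: (ergodic_maximal_inequality ms sP I0 mB c0).
move=> w nw n t n0 tn; apply: contrapT => H; apply: nw.
pose q := Num.truncn (l * n%:R).
have ln0 : 0 <= l * n%:R by rewrite mulr_ge0 // ltW.
have [q1 q2] : q%:R <= l * n%:R /\ l * n%:R < q.+1%:R.
  by have /andP[] := truncn_itv ln0.
exists (t + q.+1)%N.
rewrite /psum (eq_bigr (fun k : 'I__ => \1_B (shift (v *+ k) w))); last first.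
  by move=> k _; exact: iter_mean_unit.
rewrite big_split_ord /=.
have -> : \sum_(i < q.+1) \1_B (shift (v *+ (t + i)) w) = q.+1%:R :> R.
  rewrite (eq_bigr (fun=> 1)) ?sumr_const ?card_ord // => i _.
  rewrite indicE mem_set //; apply: contrapT => nB; apply: H.
  exists (t + i)%N; split=> //; first exact: leq_addr.
  rewrite natrD lerD2l (le_trans _ q1) // ler_nat -ltnS; exact: ltn_ord.
apply: (@lt_le_trans _ _ q.+1%:R); last first.
  by rewrite lerDr; apply: sumr_ge0 => i _; rewrite indicE.
apply: le_lt_trans q2; rewrite mulrCA ler_wpM2l ?(ltW l0) //.
rewrite ler_pdivrMr // natrD -natr1.
have t1 : t%:R <= n%:R :> R by rewrite ler_nat.
have n1 : 1 <= n%:R :> R by rewrite ler1n.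
have : l * n%:R <= n%:R by rewrite ler_piMl.
lra.
Qed.

(** The rays in the two opposite directions each cost a factor 3 / l, whence 6 / l. *)
Lemma line_density (i : 'I_d) B l : measurable B -> 0 < l -> l <= 1 ->
  exists B1, [/\ measurable B1, (P B1 <= (6 / l)%:E * P B)%E &
    forall w, ~ B1 w -> forall n (t : int), (0 < n)%N -> `|t| <= n%:Z ->
      exists2 j : int, `|(j - t)%:~R| <= l * n%:R &
        ~ B (shift (j *: delta_mx 0 i) w)].
Proof.
move=> mB l0 l1.
have [B1 [mB1 PB1 H1]] := ray_density (delta_mx 0 i) mB l0 l1.
have [B2 [mB2 PB2 H2]] := ray_density (- delta_mx 0 i) mB l0 l1.
exists (B1 `|` B2); split; first exact: measurableU.
  apply: (le_trans (measureU2 _ mB1 mB2)) => /=.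
  have f0 : P B \is a fin_num by exact: fin_num_measure.
  have f1 : P B1 \is a fin_num by exact: fin_num_measure.
  have f2 : P B2 \is a fin_num by exact: fin_num_measure.
  move: PB1 PB2; rewrite -(fineK f0) -(fineK f1) -(fineK f2) -!EFinM -EFinD !lee_fin.
  move: (fine (P B)) (fine (P B1)) (fine (P B2)) => b b1 b2 h1 h2.
  rewrite mulrAC ler_pdivlMr //; lra.
move=> w /not_orP[nB1 nB2] n t n0.
case: t => t tn.
  have [j [tj jt nB]] := H1 w nB1 n t n0 tn.
  exists j%:Z; last by rewrite -natz scaler_nat.
  rewrite rmorphB /= -!pmulrn ger0_norm ?subr_ge0 ?ler_nat //; lra.
(* [Negz t] denotes -(t + 1), hence the position [t.+1] on the opposite ray. *)
have [j [tj jt nB]] := H2 w nB2 n t.+1 n0 tn.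
exists (- j%:Z); last by rewrite scaleNr -scalerN -natz scaler_nat.
rewrite NegzE -opprD rmorphN rmorphB /= -!pmulrn normrN.
by rewrite ger0_norm ?subr_ge0 ?ler_nat //; lra.
Qed.

(** One axis at a time: the exceptional event for the first [k] axes takes the place of [B] in
    [line_density] along the next one. Keeping the later coordinates of [y] at zero lets the new
    displacement set its own coordinate alone. *)
Lemma box_density_rec k B l : (k <= d)%N -> measurable B -> 0 < l -> l <= 1 ->
  exists B1, [/\ measurable B1, (P B1 <= ((6 / l) ^+ k)%:E * P B)%E &
    forall w, ~ B1 w -> forall n x, (0 < n)%N -> (forall i, `|x 0 i| <= n%:Z) ->
      exists y, [/\ forall i : 'I_d, (i < k)%N -> `|(y 0 i - x 0 i)%:~R| <= l * n%:R,
        forall i : 'I_d, (k <= i)%N -> y 0 i = 0 &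
        ~ B (shift y w)]].
Proof.
move=> kd mB l0 l1; elim: k kd => [_|k IH kd].
  exists B; split=> //; first by rewrite expr0 mul1e.
  by move=> w nB n x _ _; exists 0; split=> // [i _|]; rewrite ?mxE ?field_shift0.
have [B1 [mB1 PB1 H1]] := IH (ltnW kd).
pose ik := Ordinal kd.
have [B2 [mB2 PB2 H2]] := line_density ik mB1 l0 l1.
exists B2; split=> //.
  apply: (le_trans PB2); rewrite exprS (EFinM (6 / l)) -muleA.
  by apply: lee_wpmul2l => //; rewrite lee_fin divr_ge0 // ltW.
move=> w nB2 n x n0 xn.
have [j jx nB1] := H2 w nB2 n (x 0 ik) n0 (xn ik).
have [y [y1 y2 nB]] := H1 _ nB1 n x n0 xn.
exists (j *: delta_mx 0 ik + y); split; last by rewrite -field_shift_shift.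
  move=> i; rewrite ltnS leq_eqVlt => /predU1P[ik'|ik'].
    have -> : i = ik by exact: val_inj.
    by rewrite !mxE !eqxx mulr1 y2 ?addr0.
  rewrite !mxE (_ : (i == ik) = false); last by rewrite -val_eqE /= ltn_eqF.
  by rewrite andbF mulr0 add0r y1.
move=> i ki; rewrite !mxE (_ : (i == ik) = false); last first.
  by rewrite -val_eqE /= gtn_eqF.
by rewrite andbF mulr0 add0r y2 // ltnW.
Qed.

Lemma box_density B l : measurable B -> 0 < l -> l <= 1 ->
  exists B1, [/\ measurable B1, (P B1 <= ((6 / l) ^+ d)%:E * P B)%E &
    forall w, ~ B1 w -> forall n x, (0 < n)%N -> (forall i, `|x 0 i| <= n%:Z) ->
      exists2 y, (norm1 (x - y))%:R <= d%:R * (l * n%:R) & ~ B (shift y w)].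
Proof.
move=> mB l0 l1; have [B1 [mB1 PB1 H]] := box_density_rec (leqnn d) mB l0 l1.
exists B1; split=> // w nB1 n x n0 xn.
have [y [y1 _ nB]] := H w nB1 n x n0 xn; exists y => //.
rewrite /norm1 natr_sum -[d in d%:R]card_ord mulr_natl -sumr_const.
apply: ler_sum => i _; apply: le_trans (y1 i (ltn_ord i)).
by rewrite !mxE -intr_norm distrC -abszE.
Qed.

(** Intersecting the covers for t = 1 / (m + 1) gives one measurable null set containing [N]. *)
Lemma negligible_of_small (N : set env) :
  (forall t, 0 < t -> exists B, [/\ measurable B, N `<=` B & (P B <= t%:E)%E]) ->
  P.-negligible N.
Proof.
move=> H.
have {}H m : exists B, [/\ measurable B, N `<=` B & (P B <= (m.+1%:R^-1)%:E)%E].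
  by apply: H; rewrite invr_gt0.
have [B HB] := choice H.
have mB : measurable (\bigcap_m B m).
  by apply: bigcap_measurable => // m _; have [] := HB m.
exists (\bigcap_m B m); split=> //; last first.
  by move=> w Nw m _; have [_ /(_ w Nw)] := HB m.
apply/eqP; rewrite eq_le measure_ge0 andbT; apply/lee_addgt0Pr => e e0.
rewrite add0e.
have [m hm] := exists_inv_succ_le e0.
have [mBm _ PB] := HB m.
apply: (@le_trans _ _ (P (B m))).
  by apply: le_measure; rewrite ?inE //; exact: bigcap_inf.
by apply: (le_trans PB); rewrite lee_fin.
Qed.

Context (Perg : ergodic P).

(** Times [j < J] are covered by the trivial bound J M, below e n^2 for large [n]. For later times a
    good point [y] near [x] contributes e / 2, and the passage from [y] to [x] contributes the other
    e / 2. *)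
Lemma uniform_psum_small (g : env -> R) (K : nat) (e : R) :
  bm g -> Ex P g = 0 -> 0 < e ->
  {ae P, forall w, \forall n \near \oo, forall j x, (j <= n ^ 2)%N ->
    (forall i, `|x 0 i| <= (K * n)%N%:Z) ->
    `|psum (@lazy_shift R d) g j (shift x w)| <= e * (n ^ 2)%:R}.
Proof.
move=> bg g0 e0; have [M gM] := bg.2.
have M0 : 0 <= M by apply: le_trans (gM point).
apply: negligible_of_small => t t0.
set L := lip_const d M; have L0 : 0 <= L by rewrite !mulr_ge0 ?sqrtr_ge0.
have e20 : 0 < e / 2 by lra.
(* [l] is chosen so that the oscillation L d (K + 1) l n^2 between [x] and [y] is at most (e / 2)
   n^2; the summand 1 keeps [D] positive. *)
pose D : R := L * d%:R * K.+1%:R + 1.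
have D0 : 0 < D by rewrite ltr_wpDl // !mulr_ge0.
pose l : R := Num.min 1 (e / 2 / D).
have l0 : 0 < l by rewrite lt_min ltr01 divr_gt0.
have l1 : l <= 1 by rewrite ge_min lexx.
have lD : L * d%:R * K.+1%:R * l <= e / 2.
  apply: (@le_trans _ _ (D * l)); first by rewrite ler_wpM2r ?(ltW l0) // lerDl.
  by rewrite mulrC -ler_pdivlMr // ge_min lexx orbT.
have c0 : 0 < (6 / l) ^+ d by rewrite exprn_gt0 // divr_gt0.
(* The factor (6 / l)^d lost in [box_density] is compensated in advance. *)
have [J HJ] := late_exceed_small d0 Pstat Perg bg g0 e20 (divr_gt0 t0 c0).
have mJ := measurable_late_exceed (e / 2) J bg.
have [B [mB PB HB]] := box_density mJ l0 l1.
exists B; split=> //; last first.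
  apply: (le_trans PB); rewrite muleC -lee_pdivlMr //.
  by apply: ltW; move: HJ; rewrite EFinM.
move=> w nw; apply: contrapT => nB; apply: nw.
exists (Num.bound (J%:R * M / e)).+1 => // n /= hn j x jn xK.
have n0 : (0 < n)%N by exact: leq_trans hn.
have n1 : 1 <= n%:R :> R by rewrite ler1n.
have nn : n%:R <= (n ^ 2)%:R :> R by rewrite ler_nat -{1}(expn1 n) leq_pexp2l.
have [jJ|Jj] := ltnP j J.
  apply: (le_trans (psum_norm_le (@lazy_shift R d) (lazy_index_gt0 d0) j gM _)).
  apply: (@le_trans _ _ (J%:R * M)); first by rewrite ler_wpM2r // ler_nat ltnW.
  rewrite [leRHS]mulrC -ler_pdivrMr //.
  apply: le_trans nn; apply: ltW; apply: lt_le_trans (archi_boundP _) _.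
    by rewrite divr_ge0 ?mulr_ge0 // ltW.
  by rewrite ler_nat ltnW.
have Kn0 : (0 < K.+1 * n)%N by rewrite muln_gt0 n0.
have xK' i : `|x 0 i| <= (K.+1 * n)%N%:Z.
  by apply: le_trans (xK i) _; rewrite lez_nat leq_mul2r leqnSn orbT.
have [y yx ny] := HB w nB _ x Kn0 xK'.
have Sy : `|psum (@lazy_shift R d) g j (shift y w)| <= j%:R * (e / 2).
  by rewrite leNgt; apply/negP => h; apply: ny; exists j.
have Sxy := psum_shift_diff_le d0 j (x - y) (shift y w) gM.
have yxy : y + (x - y) = x by rewrite addrC subrK.
rewrite field_shift_shift yxy -/L in Sxy.
have sj : Num.sqrt j%:R <= n%:R :> R.
  rewrite -(@ler_pXn2r _ 2) ?nnegrE ?sqrtr_ge0 ?ler0n //.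
  by rewrite sqr_sqrtr ?ler0n // -natrX ler_nat.
have h1 : j%:R * (e / 2) <= (n ^ 2)%:R * (e / 2).
  by rewrite ler_wpM2r ?(ltW e20) // ler_nat.
have h2 : L * Num.sqrt j%:R * (norm1 (x - y))%:R <= (e / 2) * (n ^ 2)%:R.
  apply: (@le_trans _ _ (L * n%:R * (d%:R * (l * (K.+1 * n)%:R)))).
    by apply: ler_pM => //; rewrite ?mulr_ge0 ?sqrtr_ge0 // ler_wpM2l.
  have -> : L * n%:R * (d%:R * (l * (K.+1 * n)%:R)) = L * d%:R * K.+1%:R * l * (n ^ 2)%:R.
    by rewrite natrM natrX; ring.
  by rewrite ler_wpM2r.
have -> : psum (@lazy_shift R d) g j (shift x w) =
  (psum (@lazy_shift R d) g j (shift x w) - psum (@lazy_shift R d) g j (shift y w))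
  + psum (@lazy_shift R d) g j (shift y w) by rewrite subrK.
apply: (le_trans (ler_normD _ _)).
rewrite [e]splitr mulrDl; apply: lerD; first exact: le_trans h2.
by apply: (le_trans Sy); rewrite [leRHS]mulrC.
Qed.

End Density.

(** * Comparison of odometers, and geometry of the blown-up domain *)

Section Comparison.
Context (R : realType) (d : nat) (d0 : (0 < d)%N).
Implicit Types (f h u : 'rV[int]_d -> R) (V : set 'rV[int]_d).

Lemma laplacianD f h x :
  laplacian (fun y => f y + h y) x = laplacian f x + laplacian h x.
Proof.
rewrite !laplacian_lstepE -big_split; apply: eq_bigr => p _ /=; ring.
Qed.

Lemma laplacianZ (c : R) f x : laplacian (fun y => c * f y) x = c * laplacian f x.
Proof.
by rewrite !laplacian_lstepE mulr_sumr; apply: eq_bigr => p _; rewrite mulrBr.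
Qed.

Lemma laplacian_cst (c : R) (x : 'rV[int]_d) : laplacian (fun=> c) x = 0.
Proof. by rewrite laplacian_lstepE big1 // => p _; rewrite subrr. Qed.

Lemma laplacian_sqr_coord (i : 'I_d) (x : 'rV[int]_d) :
  laplacian (fun y => (y 0 i)%:~R ^+ 2) x = 2 :> R.
Proof.
rewrite laplacianE (bigD1 i) //= big1 => [|j].
  by rewrite !mxE !eqxx !rmorphD /= rmorphN /=; ring.
rewrite eq_sym => /negbTE ij; rewrite !mxE eqxx ij /=.
by rewrite ?addr0 ?subr0 ?addr0; ring.
Qed.

(** [odometer V f2 + h + a] competes for [f1]. Only an inequality on the Laplacian of [h] is asked
    for, so an approximate solution can be corrected by a quadratic. *)
Lemma odometer_le_add V f1 f2 h (a : R) : finite_set V ->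
  (forall x, lclosure R V x -> `|h x| <= a) ->
  (forall x, V x -> laplacian h x + f1 x <= f2 x) ->
  forall x, lclosure R V x -> odometer V f1 x <= odometer V f2 x + 2 * a.
Proof.
move=> fV ha hV x Vx.
have [[v0 v1] _] := odometer_min f2 d0 fV.
have [_ vmin] := odometer_min f1 d0 fV.
pose u y := odometer V f2 y + (h y + a).
apply: (@le_trans _ _ (u x)).
  apply: vmin => //; split=> y Vy.
    have := ha y Vy; rewrite ler_norml => /andP[h1 _].
    by rewrite addr_ge0 ?v0 // -lerBlDr sub0r.
  rewrite !laplacianD laplacian_cst.
  have := v1 y Vy; have := hV y Vy; lra.
have := ha x Vx; rewrite ler_norml => /andP[_ h1]; rewrite /u; lra.
Qed.

Lemma lclosure_blowup_le (W : set 'rV[R]_d) : bounded_set W ->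
  exists K : nat, forall n, (0 < n)%N -> forall x, lclosure R (blowup W n) x ->
    forall i, `|x 0 i| <= (K * n)%N%:Z.
Proof.
move=> [M0 [_ /(_ (M0 + 1))]]; rewrite ltrDl ltr01 => /(_ isT) /=.
set M := M0 + 1 => HM; pose N := Num.bound `|M|.
have MN : M <= N%:R.
  by apply: (le_trans (ler_norm _)); exact/ltW/archi_boundP.
have bl n x i : blowup W n x -> `|x 0 i| <= (N * n)%N%:Z.
  move=> [v Wv xv]; rewrite -(ler_int R) intr_norm -pmulrn.
  have -> : (x 0 i)%:~R = n%:R * v 0 i by move/rowP: xv => /(_ i); rewrite !mxE.
  rewrite normrM normr_nat natrM mulrC ler_wpM2r //; apply: le_trans MN.
  apply: le_trans (HM _ Wv); rewrite /Num.norm /= mx_normE.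
  exact: (le_bigmax _ (fun ij : 'I_1 * 'I_d => `|v ij.1 ij.2|%:nng) (0, i)).
(* A boundary point is one lattice step away from the blow-up; the extra [n >= 1] absorbs that
   step. *)
exists N.+1 => n n0 x [Vx|[_ [y Vy yx]]] i.
  by apply: (le_trans (bl n x i Vx)); rewrite lez_nat leq_mul2r leqnSn orbT.
move: yx; rewrite nbr_lstepE => -[p _ <-].
have h := bl n y i Vy; rewrite !mxE (le_trans (ler_normD _ _)) //.
have s2 : `|(-1) ^+ p.2 * ((0 == 0 :> 'I_1) && (i == p.1))%:R : int| <= 1.
  by case: p.2; case: (i == p.1).
rewrite mulSn addnC PoszD; apply: lerD => //; apply: (le_trans s2).
by rewrite lez_nat.
Qed.

(** Rounding n v moves each coordinate by at most 1, so after division by [n] the point stays in a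
    ball around v inside [W] once 1 / n < r. *)
Lemma blowup_nonempty (W : set 'rV[R]_d) : W !=set0 -> open W ->
  \forall n \near \oo, blowup W n !=set0.
Proof.
move=> [v Wv] oW; have /nbhs_ballP[r /= r0 rW] := open_nbhs_nbhs (conj oW Wv).
exists (Num.bound r^-1).+1 => // n /= hn.
have n0 : 0 < n%:R :> R by rewrite ltr0n (leq_trans _ hn).
exists (lround (n%:R *: v)); exists (n%:R^-1 *: to_real R (lround (n%:R *: v))).
  apply: rW; split=> // i j; rewrite /ball /= !mxE (ord1 i).
  set t := n%:R * v 0 j; set m := Num.floor _.
  have /andP[m1 m2] : m%:~R <= t + 2^-1 < (m + 1)%:~R.
    by apply: real_floor_itv; exact: num_real.
  have -> : v 0 j - n%:R^-1 * m%:~R = n%:R^-1 * (t - m%:~R).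
    by rewrite /t mulrBr mulKf // gt_eqF.
  rewrite normrM ger0_norm ?invr_ge0 ?(ltW n0) // mulrC ltr_pdivrMr //.
  apply: (@le_lt_trans _ _ 1).
    by rewrite rmorphD /= in m2; rewrite ler_norml; apply/andP; split; lra.
  rewrite mulrC -ltr_pdivrMr // div1r.
  apply: lt_trans (archi_boundP _) _; first by rewrite invr_ge0 ltW.
  by rewrite ltr_nat.
by rewrite scalerA divff ?scale1r // gt_eqF.
Qed.

(** Nonemptiness provides the lower bound 0, the supremum of the empty set being -oo. *)
Lemma ereal_sup_cvg0 (T : Type) (A : nat -> set T) (F : nat -> T -> R) :
  (\forall n \near \oo, A n !=set0) ->
  (forall e, 0 < e -> \forall n \near \oo, forall x, A n x -> `|F n x| <= e) ->
  ereal_sup [set `|F n x|%:E | x in A n] @[n --> \oo] --> 0%E.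
Proof.
move=> A0 FA.
have bnd (e : R) : 0 < e -> \forall n \near \oo,
    (0 <= ereal_sup [set `|F n x|%:E | x in A n] <= e%:E)%E.
  move=> e0; near=> n; apply/andP; split.
    have [x Ax] : A n !=set0 by near: n.
    by apply: ereal_sup_ge; exists `|F n x|%:E; [exists x|rewrite lee_fin].
  apply: ge_ereal_sup => _ [x Ax <-]; rewrite lee_fin.
  by move: x Ax; near: n; exact: FA.
apply/fine_cvgP; split.
  near=> n; have /andP[h1 h2] : (0 <= ereal_sup [set `|F n x|%:E | x in A n] <= 1%:E)%E.
    by near: n; exact: bnd.
  by rewrite ge0_fin_numE // (le_lt_trans h2) // ltry.
apply/cvgrPdist_le => e e0; near=> n.
have /andP[h1 h2] : (0 <= ereal_sup [set `|F n x|%:E | x in A n] <= e%:E)%E.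
  by near: n; exact: bnd.
rewrite /= sub0r normrN ger0_norm ?fine_ge0 // -lee_fin fineK //.
by rewrite ge0_fin_numE // (le_lt_trans h2) // ltry.
Unshelve. all: by end_near.
Qed.

End Comparison.

(** * The approximate solution of the Poisson equation *)

Section Corrector.
Context (R : realType) (d : nat) (d0 : (0 < d)%N).
Local Notation env := (environment R d).
Implicit Types (g : env -> R) (w : env) (x : 'rV[int]_d).

Local Notation psum := (psum (@lazy_shift R d)).

Definition corrector g (N : nat) w x : R :=
  - ((4 * d)%:R * N%:R)^-1 * \sum_(j < N) psum g j (shift x w).

Lemma mean_sum (s : lazy_index d -> env -> env) n (F : nat -> env -> R) w :
  mean s (fun v => \sum_(j < n) F j v) w = \sum_(j < n) mean s (F j) w.
Proof.
by rewrite /mean exchange_big /= mulr_sumr.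
Qed.

(** By [psumS], applying [mean] - 1 to [psum g j] gives [psum g j.+1 - psum g j - g], which
    telescopes over [j < N]; the prefactor cancels the 4 d of [laplacian_mean]. *)
Lemma laplacian_corrector g N w x : (0 < N)%N ->
  laplacian (corrector g N w) x = g (shift x w) - psum g N (shift x w) / N%:R.
Proof.
move=> N0; rewrite laplacianZ; set D := (4 * d)%:R.
have D0 : D != 0 :> R by rewrite pnatr_eq0 muln_eq0 -lt0n d0.
have N0' : N%:R != 0 :> R by rewrite pnatr_eq0 -lt0n.
rewrite (laplacian_mean d0 (fun v => \sum_(j < N) psum g j v)) mean_sum -/D.
have -> : \sum_(j < N) mean (@lazy_shift R d) (psum g j) (shift x w) =
    \sum_(j < N) (psum g j.+1 (shift x w) - g (shift x w)).
  by apply: eq_bigr => j _; rewrite psumS addrAC subrr add0r.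
rewrite -sumrB.
have -> : \sum_(j < N) (psum g j.+1 (shift x w) - g (shift x w) -
    psum g j (shift x w)) = psum g N (shift x w) - N%:R * g (shift x w).
  elim: N {N0 N0'} => [|N IH]; first by rewrite big_ord0 psum0 mul0r subr0.
  by rewrite big_ord_recr /= IH -natr1; ring.
move: N%:R N0' D D0 => r r0 D D0; field; by rewrite D0 r0.
Qed.

(** Up to a factor 1 / (4 d) <= 1, the corrector is minus the average of [psum g j] over [j < N]. *)
Lemma corrector_le g N w x (a : R) : (0 < N)%N ->
  (forall j, (j <= N)%N -> `|psum g j (shift x w)| <= a) ->
  `|corrector g N w x| <= a.
Proof.
move=> N0 ha; rewrite /corrector normrM normrN normfV.
have a0 : 0 <= a by apply: le_trans (ha 0%N _).
have D1 : 1 <= (4 * d)%:R :> R by rewrite ler1n muln_gt0.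
have N0' : 0 < N%:R :> R by rewrite ltr0n.
rewrite (@ger0_norm _ (_ * _)) ?mulr_ge0 // mulrC ler_pdivrMr; last first.
  by rewrite mulr_gt0 // (lt_le_trans ltr01).
apply: (@le_trans _ _ (\sum_(j < N) a)).
  apply: (le_trans (ler_norm_sum _ _ _)); apply: ler_sum => j _.
  by apply: ha; exact: ltnW.
rewrite sumr_const card_ord -[a *+ _]mulr_natr ler_wpM2l //.
by rewrite ler_peMl // ltW.
Qed.

End Corrector.

(** * Two-sided comparison of the odometers through the corrector *)

Theorem theorem8p2 (R : realType) (d : nat) (hd : (2 <= d)%N)
    (P : probability (environment R d) R)
    (Pstat : stationary P) (Perg : ergodic P)
    (eta_min eta_max : R)
    (Pbnd : forall x : 'rV[int]_d,
      P [set eta : environment R d | eta_min <= eta x <= eta_max] = 1%E)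
    (W : set 'rV[R]_d) (hW : bounded_lipschitz_domain W) :
  let eta_avg : R := fine ('E_P[fun eta : environment R d => eta 0%R])%E in
  let vbar (eta : environment R d) (n : nat) : 'rV[R]_d -> R :=
    rescale n (odometer (blowup W n) eta) in
  let vbar_avg (n : nat) : 'rV[R]_d -> R :=
    rescale n (odometer (blowup W n) (fun=> eta_avg)) in
  {ae P, forall eta : environment R d,
    ereal_sup [set `|vbar eta n x - vbar_avg n x|%:E | x in scaled_closure W n]
      @[n --> \oo] --> 0%E}.
Proof.
move=> eta_avg vbar vbar_avg.
have d0 : (0 < d)%N by exact: leq_trans hd.
have [W0 oW _ bW _] := hW.
have [K HK] := lclosure_blowup_le bW.
(* The bounds on the coordinates hold only almost surely, while [bounded_measurable] wants one bound
   at every environment; the truncation agrees with the coordinate almost surely. *)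
pose clamp (t : R) := Num.max eta_min (Num.min eta_max t).
pose c0 (w : environment R d) := clamp (w 0).
have mc0 : measurable_fun setT c0.
  apply: measurable_maxr; first exact: measurable_cst.
  by apply: measurable_minr; [exact: measurable_cst|exact: measurable_coordinate].
have bc0 : bounded_measurable c0.
  split=> //; exists (`|eta_min| + `|eta_max|) => w; rewrite /c0 /clamp.
  move: (w 0) => t; rewrite ler_norml.
  have [h1 h2] := (ler_norm eta_min, ler_norm (- eta_min)).
  have [h3 h4] := (ler_norm eta_max, ler_norm (- eta_max)).
  have [h5 h6] := (normr_ge0 eta_min, normr_ge0 eta_max).
  rewrite normrN in h2; rewrite normrN in h4.
  case: (leP eta_max t) => ?; [case: (leP eta_min eta_max)|case: (leP eta_min t)] => ?;
    apply/andP; split; lra.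
have clampE (t : R) : eta_min <= t <= eta_max -> clamp t = t.
  by move=> /andP[h1 h2]; rewrite /clamp (min_idPr h2) (max_idPr h1).
have ae_bnd x : {ae P, forall w : environment R d, eta_min <= w x <= eta_max}.
  have mE : measurable [set w : environment R d | eta_min <= w x <= eta_max].
    rewrite (_ : [set _ | _] =
        (fun w : environment R d => w x) @^-1` `[eta_min, eta_max]%classic).
      by rewrite -[X in measurable X]setTI; exact: measurable_coordinate.
    by apply/seteqP; split => w /=; rewrite in_itv.
  exists (~` [set w : environment R d | eta_min <= w x <= eta_max]); split=> //.
    exact: measurableC.
  by rewrite probability_setC // Pbnd subee.
have Ec0 : Ex P c0 = eta_avg.
  rewrite /eta_avg unlock /Ex /Rintegral; congr fine.
  apply: ae_eq_integral => //.
  - exact/measurable_EFinP.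
  - by apply/measurable_EFinP; exact: measurable_coordinate.
  by move: (ae_bnd 0); apply: filterS => w h _ /=; rewrite /c0 clampE.
pose g (w : environment R d) := eta_avg + -1 * c0 w.
have bg : bounded_measurable g.
  by apply: bmD; [exact: bm_cst|apply: bmM => //; exact: bm_cst].
have g0 : Ex P g = 0.
  rewrite ExD; [|exact: bm_cst|by apply: bmM => //; exact: bm_cst].
  by rewrite ExZ // Ex_cst Ec0 mulN1r subrr.
have ae_all : {ae P, forall w : environment R d, forall x, eta_min <= w x <= eta_max}.
  have : {ae P, forall w : environment R d, forall m,
      if unpickle m is Some x then eta_min <= w x <= eta_max else true}.
    apply/ae_foralln => m; case: (unpickle m) => [x|]; first exact: ae_bnd.
    by apply: aeW.
  apply: filterS => w H x; have := H (pickle x); by rewrite pickleK.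
(* Tolerances 1 / (k + 1) make the intersection countable, so that one event of full probability
   serves every [e]. *)
have ae_small : {ae P, forall w : environment R d, forall k : nat,
    \forall n \near \oo, forall j (x : 'rV[int]_d), (j <= n ^ 2)%N ->
    (forall i, `|x 0 i| <= (K * n)%N%:Z) ->
    `|psum (@lazy_shift R d) g j (shift x w)| <= k.+1%:R^-1 * (n ^ 2)%:R}.
  by apply/ae_foralln => k; apply: uniform_psum_small.
move: ae_all ae_small; apply: filterS2 => w w_bnd w_small.
apply: ereal_sup_cvg0.
  have := blowup_nonempty W0 oW; apply: filterS => n [z Vz].
  by exists (n%:R^-1 *: to_real R z), z => //; left.
move=> e e0.
(* The final bound is 2 a = C e' n^2, where [a] adds the bound e' n^2 on the corrector to the bound
   e' K^2 n^2 on the quadratic term. *)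
pose C : R := 2 * (1 + K%:R ^+ 2).
have C0 : 0 < C by rewrite mulr_gt0 // ltr_pwDl // sqr_ge0.
have [k hk] := exists_inv_succ_le (divr_gt0 e0 C0).
set e' : R := k.+1%:R^-1 in hk; have e'0 : 0 < e' by rewrite invr_gt0.
have := w_small k; rewrite -/e' => -[n1 _ Hn1].
exists n1.+1 => // n /= hn _ [x Vx <-].
have n0 : (0 < n)%N by exact: leq_trans hn.
have {}Hn1 := Hn1 n (ltnW hn).
rewrite /vbar /vbar_avg /rescale scalerA divff ?pnatr_eq0 -?lt0n // scale1r.
rewrite lround_to_real -mulrBr normrM ger0_norm ?invr_ge0 ?exprn_ge0 //.
have N0 : (0 < n ^ 2)%N by rewrite expn_gt0 n0.
pose i0 := Ordinal d0.
(* [q] has Laplacian 2, so subtracting [e' * q] lowers the Laplacian by 2 e', more than the error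
   [psum g N / N] of the corrector, which is at most e'. *)
pose q (y : 'rV[int]_d) : R := (y 0 i0)%:~R ^+ 2.
set V := blowup W n in Vx *; have fV : finite_set V by exact: finite_blowup.
pose h := corrector g (n ^ 2) w.
set a : R := e' * (n ^ 2)%:R * (1 + K%:R ^+ 2).
have qa y : lclosure R V y -> `|q y| <= K%:R ^+ 2 * (n ^ 2)%:R.
  move=> Vy; rewrite /q normrX natrX -exprMn ler_pXn2r ?nnegrE ?mulr_ge0 //.
  have := HK n n0 y Vy i0.
  by rewrite -(ler_int R) intr_norm -pmulrn natrM.
have ha y : lclosure R V y -> `|h y| <= e' * (n ^ 2)%:R.
  move=> Vy; apply: corrector_le => // j jn; apply: Hn1 => //; exact: HK.
(* The sign [s] serves both directions: 1 bounds the odometer of [w] by that of [eta_avg], and -1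
   gives the reverse. *)
have haq (s : R) y : `|s| = 1 -> lclosure R V y -> `|s * h y + - e' * q y| <= a.
  move=> s1 Vy; move: (h y) (q y) (ha y Vy) (qa y Vy) => b c hb hc.
  apply: (le_trans (ler_normD _ _)); rewrite !normrM s1 mul1r.
  rewrite normrN (ger0_norm (ltW e'0)) /a mulrDr mulr1 lerD //.
  by rewrite -mulrA ler_wpM2l ?(ltW e'0) // mulrC.
have gE y : g (shift y w) = eta_avg - w y.
  by rewrite /g mulN1r /c0 /= addr0 clampE.
have psN y : V y -> `|psum (@lazy_shift R d) g (n ^ 2) (shift y w) / (n ^ 2)%:R| <= e'.
  move=> Vy; rewrite normrM normfV (ger0_norm (ler0n _ _)) ler_pdivrMr ?ltr0n //.
  by apply: Hn1 => //; apply: HK => //; left.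
have lapE (s : R) y : laplacian (fun y => s * h y + - e' * q y) y =
    s * (eta_avg - w y -
      psum (@lazy_shift R d) g (n ^ 2) (shift y w) / (n ^ 2)%:R) - e' * 2.
  rewrite laplacianD (laplacianZ s) (laplacianZ (- e')) (laplacian_corrector d0) // gE.
  by rewrite laplacian_sqr_coord mulNr.
have le1 : odometer V w x <= odometer V (fun=> eta_avg) x + 2 * a.
  apply: (@odometer_le_add _ _ d0 _ _ _ (fun y => 1 * h y + - e' * q y)) => //.
    by move=> y; apply: haq; rewrite normr1.
  move=> y Vy; rewrite lapE; have := psN y Vy; rewrite ler_norml => /andP[].
  move: (psum _ _ _ _ / _) => t; lra.
have le2 : odometer V (fun=> eta_avg) x <= odometer V w x + 2 * a.
  apply: (@odometer_le_add _ _ d0 _ _ _ (fun y => -1 * h y + - e' * q y)) => //.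
    by move=> y; apply: haq; rewrite normrN1.
  move=> y Vy; rewrite lapE; have := psN y Vy; rewrite ler_norml => /andP[].
  move: (psum _ _ _ _ / _) => t; lra.
rewrite mulrC ler_pdivrMr ?exprn_gt0 ?ltr0n //.
apply: (@le_trans _ _ (2 * a)).
  by rewrite ler_norml; apply/andP; split; lra.
have -> : 2 * a = C * e' * n%:R ^+ 2 by rewrite /a /C natrX; ring.
by rewrite ler_wpM2r ?exprn_ge0 // mulrC -ler_pdivlMr.
Qed.
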